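(* Let $\mathcal H$ be a separable Hilbert space, let $S$ be a bounded operator on $\mathcal H$ with $0\le S\le I$, and let $0<\varepsilon<\tfrac12$. Put $t_\varepsilon:=\sqrt{\varepsilon(1-\varepsilon)}$ and $D_S:=(S-S^2)^{1/2}$. Then $$\Lambda_\varepsilon(S)=n(t_\varepsilon;D_S).$$ Consequently, if $S-S^2$ is compact (compactness of $S$ itself is not required), then $\Lambda_\varepsilon(S)<\infty$ for every fixed $0<\varepsilon<\tfrac12$.
   Context: For a positive contraction $S$ ($0\le S\le I$), $\Lambda_\varepsilon(S):=\operatorname{rank}\mathbf 1_{(\varepsilon,1-\varepsilon)}(S)$, where $\mathbf 1_{(\varepsilon,1-\varepsilon)}(S)$ is the spectral projection of $S$ for the open interval. For a bounded operator $A$ between separable Hilbert spaces and $\tau>0$, $n(\tau;A):=\operatorname{rank}\mathbf 1_{(\tau,\infty)}(|A|)$ with $|A|=(A^*A)^{1/2}$; both quantities may be $+\infty$. *)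

(* Defs.v *)
From HB Require Import structures.
From mathcomp Require Import all_boot all_order all_algebra.
From mathcomp Require Import sesquilinear complex.
From mathcomp Require Import all_classical all_reals all_analysis.

Set Implicit Arguments.
Unset Strict Implicit.
Unset Printing Implicit Defensive.

Import Order.TTheory GRing.Theory Num.Theory.
Import numFieldNormedType.Exports.

Local Open Scope classical_set_scope.
Local Open Scope complex_scope.
Local Open Scope ring_scope.

(* Complex Hilbert spaces. The norm of a normedModType over R[i] takes its
   (nonnegative real) values in R[i]. The inner product is linear in its first
   argument and conjugate-linear in its second one. *)
HB.mixin Record NormedModule_isHilbert (R : realType) H
    of CompleteNormedModule R[i] H := {
  hdot : {dot H for (Num.conj : R[i] -> R[i])} ;
  sqr_normE : forall x : H, `|x| ^+ 2 = hdot x x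
}.

#[short(type="hilbertType")]
HB.structure Definition Hilbert (R : realType) :=
  { H of NormedModule_isHilbert R H & CompleteNormedModule R[i] H }.

Definition dotp (R : realType) (H : hilbertType R) (x y : H) : R[i] :=
  (hdot : {dot H for _}) x y.

Definition separable (T : topologicalType) : Prop :=
  exists2 D : set T, countable D & dense D.

Section operators.
Context (R : realType).
Implicit Types H : hilbertType R.

Definition bounded_operator (H1 H2 : hilbertType R) (A : H1 -> H2) : Prop :=
  linear A /\ exists M : R[i], forall x, `|A x| <= M * `|x|.

(* In R[i], a <= b means that b - a is real and nonnegative; hence op_le A B
   makes B - A self-adjoint. *)
Definition op_le H (A B : H -> H) : Prop :=
  forall x, dotp (A x) x <= dotp (B x) x.

Definition compact_operator (H1 H2 : hilbertType R) (A : H1 -> H2) : Prop :=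
  compact (closure (A @` [set x | `|x| <= 1])).

Definition adjoint (H1 H2 : hilbertType R) (A : H1 -> H2) : H2 -> H1 :=
  xget (cst 0) [set B : H2 -> H1 | bounded_operator B /\
    forall x y, dotp (A x) y = dotp x (B y)].

Definition sqrt_op H (T : H -> H) : H -> H :=
  xget (cst 0) [set B : H -> H |
    [/\ bounded_operator B, op_le (cst 0) B & B \o B = T]].

Definition abs_op (H1 H2 : hilbertType R) (A : H1 -> H2) : H1 -> H1 :=
  sqrt_op (adjoint A \o A).

Definition orthogonal_projection H (P : H -> H) : Prop :=
  [/\ bounded_operator P, P \o P = P &
      forall x y, dotp (P x) y = dotp x (P y)].

(* The scalar measure B |-> <E(B) x, x>. *)
Definition scalar_measure H (E : set R -> H -> H) (x : H) : set R -> \bar R :=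
  fun B => (complex.Re (dotp (E B x) x))%:E.

(* E is a projection-valued measure on the Borel sets of the real line,
   countably additive in the strong operator topology, and S is the integral
   of the identity function against E. *)
Definition is_spectral_measure H (S : H -> H) (E : set R -> H -> H) : Prop :=
  [/\ forall B, measurable B -> orthogonal_projection (E B),
      E setT = id,
      forall A B, measurable A -> measurable B -> E (A `&` B) = E A \o E B,
      forall F : (set R)^nat, (forall k, measurable (F k)) ->
        trivIset setT F -> forall x,
        (fun n => \sum_(0 <= k < n) E (F k) x) @ \oo -->
          E (\bigcup_k F k) x
    & forall x,
        (scalar_measure E x).-integrable setT (EFin : R -> \bar R) /\
        dotp (S x) x =
          (fine (\int[scalar_measure E x]_(t in [set: R]) t%:E))%:C].

(* The spectral projection of the bounded self-adjoint operator S for the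
   Borel set B; the spectral theorem makes the choice of E legitimate, and E is
   unique on Borel sets. *)
Definition spectral_projection H (S : H -> H) (B : set R) : H -> H :=
  xget (fun=> cst 0) [set E | is_spectral_measure S E] B.

Definition linearly_independent H (n : nat) (v : 'I_n -> H) : Prop :=
  forall c : 'I_n -> R[i], \sum_(i < n) c i *: v i = 0 -> forall i, c i = 0.

(* The dimension of the range, +oo when the range is infinite-dimensional. *)
Definition oprank (H1 H2 : hilbertType R) (A : H1 -> H2) : \bar R :=
  ereal_sup [set (n%:R)%:E | n in [set n : nat |
    exists v : 'I_n -> H2,
      linearly_independent v /\ forall i, range A (v i)]].

Definition Lambda H (eps : R) (S : H -> H) : \bar R :=
  oprank (spectral_projection S `]eps, 1 - eps[).

Definition ncount (H1 H2 : hilbertType R) (tau : R) (A : H1 -> H2) : \bar R :=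
  oprank (spectral_projection (abs_op A) `]tau, +oo[).

End operators.

(* Main.v *)
(* Write [T = S - S^2].  The range of a spectral projection [P] is governed by
   the quadratic form of [T] alone: on [ran 1_]eps, 1 - eps[(S)] one has
   [<T x, x> > eps (1 - eps) |x|^2] for [x <> 0], on its kernel the reverse weak
   inequality, and the same dichotomy holds for [1_]tau, +oo[(D)] because
   [D^2 = T].  Hence each projection is injective on the range of the other one,
   and the ranks agree.  If [T] is compact, a finite [eps (1 - eps)]-net of the
   image of the unit ball bounds the rank: in a larger independent family some
   unit combination [u] has [T u] orthogonal to the net.

   The spectral theorem itself is needed to know that the projections exist.
   With [X = S - t] rescaled into [[-1, 1]], the polynomials given by the
   Newton-Schulz iteration [s -> s (3 - s^2) / 2] started at [X] converge
   strongly to [sgn X], which yields the projection for [`]t, +oo[].  Each vector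
   [x] then has a Lebesgue-Stieltjes measure, and a Dynkin-class argument turns
   these measures into projections for all Borel sets. *)
Require Import Defs.
From HB Require Import structures.
From mathcomp Require Import all_boot all_order all_algebra.
From mathcomp Require Import finmap.
From mathcomp Require Import sesquilinear complex.
From mathcomp Require Import all_classical all_reals all_analysis.
From mathcomp Require Import measurable_realfun.
From mathcomp Require Import ring lra.

Set Implicit Arguments.
Unset Strict Implicit.
Unset Printing Implicit Defensive.

Import Order.TTheory GRing.Theory Num.Theory.
Import numFieldNormedType.Exports.
Import HBNNSimple.

Local Open Scope classical_set_scope.
Local Open Scope complex_scope.
Local Open Scope ring_scope.

(** * The real inner product and bounded operators *)

Lemma cvgR_unique (R : realType) (u : nat -> R) (l m : R) :
  u @ \oo --> l -> u @ \oo --> m -> l = m.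
Proof. by move=> ul um; apply: (@norm_cvg_unique _ R _ _ _ _ ul um). Qed.

Lemma cvgR_ge (R : realType) (u : nat -> R) (l c : R) :
  u @ \oo --> l -> (forall n, c <= u n) -> c <= l.
Proof.
move=> ul cu; rewrite -(cvg_lim (@Rhausdorff R) ul).
by apply: limr_ge; [exact: cvgP ul|exact: nearW].
Qed.

Lemma cvgR_le (R : realType) (u : nat -> R) (l c : R) :
  u @ \oo --> l -> (forall n, u n <= c) -> l <= c.
Proof.
move=> ul cu; rewrite -(cvg_lim (@Rhausdorff R) ul).
by apply: limr_le; [exact: cvgP ul|exact: nearW].
Qed.

Section real_inner_product.
Context (R : realType) (H : hilbertType R).
Implicit Types (x y z : H) (r : R).

(** The real part keeps every estimate in the ordered field [R]; for symmetric linear operators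
    [rsym_dotp] recovers the complex inner product. *)
Definition rdot x y : R := complex.Re (dotp x y).

Definition nrm x : R := Num.sqrt (rdot x x).

Lemma dotpC x y : dotp x y = (dotp y x)^*.
Proof. by rewrite /dotp hermC /= expr0 mul1r. Qed.

Lemma dotpDl x y z : dotp (x + y) z = dotp x z + dotp y z.
Proof. by rewrite /dotp linearDl. Qed.

Lemma dotp0l x : dotp 0 x = 0.
Proof. by rewrite /dotp linear0l. Qed.

Lemma dotpZl (a : R[i]) x y : dotp (a *: x) y = a * dotp x y.
Proof. by rewrite /dotp linearZl_LR. Qed.

Lemma rdotC x y : rdot x y = rdot y x.
Proof. by rewrite /rdot dotpC; case: (dotp y x). Qed.

Lemma rdotDl x y z : rdot (x + y) z = rdot x z + rdot y z.
Proof. by rewrite /rdot dotpDl; case: (dotp x z); case: (dotp y z). Qed.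

Lemma rdotZl r x y : rdot (r%:C *: x) y = r * rdot x y.
Proof.
by rewrite /rdot dotpZl; case: (dotp x y) => a b /=; rewrite mul0r subr0.
Qed.

Lemma rdotNl x y : rdot (- x) y = - rdot x y.
Proof.
have -> : - x = (-1)%:C *: x by rewrite rmorphN1 scaleN1r.
by rewrite rdotZl mulN1r.
Qed.

Lemma rdotBl x y z : rdot (x - y) z = rdot x z - rdot y z.
Proof. by rewrite rdotDl rdotNl. Qed.

Lemma rdot0l y : rdot 0 y = 0.
Proof. by rewrite -(subrr 0) rdotBl subrr. Qed.

Lemma rdotDr x y z : rdot z (x + y) = rdot z x + rdot z y.
Proof. by rewrite rdotC rdotDl !(rdotC z). Qed.

Lemma rdotZr r x y : rdot y (r%:C *: x) = r * rdot y x.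
Proof. by rewrite rdotC rdotZl rdotC. Qed.

Lemma rdotNr x y : rdot y (- x) = - rdot y x.
Proof. by rewrite rdotC rdotNl rdotC. Qed.

Lemma rdotBr x y z : rdot z (x - y) = rdot z x - rdot z y.
Proof. by rewrite rdotDr rdotNr. Qed.

Lemma rdot0r y : rdot y 0 = 0.
Proof. by rewrite rdotC rdot0l. Qed.

Definition rdotE := (rdotDl, rdotDr, rdotBl, rdotBr, rdotNl, rdotNr, rdotZl,
  rdotZr, rdot0l, rdot0r).

Lemma dotpp x : dotp x x = (rdot x x)%:C.
Proof.
have /ger0_Im : 0 <= dotp x x by rewrite /dotp -sqr_normE exprn_ge0.
by rewrite /rdot; case: (dotp x x) => a b /= ->.
Qed.

Lemma rdot_ge0 x : 0 <= rdot x x.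
Proof. by rewrite -ler0c -dotpp /dotp -sqr_normE exprn_ge0. Qed.

Lemma nrm_ge0 x : 0 <= nrm x.
Proof. exact: sqrtr_ge0. Qed.

Lemma sqr_nrm x : nrm x ^+ 2 = rdot x x.
Proof. by rewrite sqr_sqrtr// rdot_ge0. Qed.

Lemma normE x : `|x| = (nrm x)%:C.
Proof.
apply/eqP; rewrite -(@eqrXn2 _ 2)//; last by rewrite ler0c nrm_ge0.
by rewrite sqr_normE -[X in X == _]/(dotp x x) dotpp -rmorphXn sqr_nrm.
Qed.

Lemma rdot_eq0 x : rdot x x = 0 -> x = 0.
Proof. by move=> x0; apply/normr0_eq0; rewrite normE /nrm x0 sqrtr0. Qed.

Lemma rdot_gt0 x : x <> 0 -> 0 < rdot x x.
Proof.
move=> x0; rewrite lt_neqAle rdot_ge0 andbT; apply/eqP => /esym.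
by move=> /rdot_eq0.
Qed.

Lemma rdot_eq x y : (forall z, rdot x z = rdot y z) -> x = y.
Proof.
move=> e; apply/eqP; rewrite -subr_eq0; apply/eqP/rdot_eq0.
by rewrite rdotBl e subrr.
Qed.

Lemma nrmD x y : nrm (x + y) <= nrm x + nrm y.
Proof. by have := ler_normD x y; rewrite !normE -rmorphD lecR. Qed.

Lemma nrmN x : nrm (- x) = nrm x.
Proof. by apply: complexI; rewrite -!normE normrN. Qed.

Lemma nrmBC x y : nrm (x - y) = nrm (y - x).
Proof. by rewrite -nrmN opprB. Qed.

Lemma nrmB x y z : nrm (x - z) <= nrm (x - y) + nrm (y - z).
Proof. by rewrite -[x in nrm (x - z)](subrK y) -addrA nrmD. Qed.

Lemma nrm_le x r : 0 <= r -> rdot x x <= r ^+ 2 -> nrm x <= r.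
Proof. by move=> r0 xr; rewrite -(@ler_pXn2r _ 2)// ?nnegrE ?nrm_ge0// sqr_nrm. Qed.

Lemma nrm_rdot_le x y : rdot x x <= rdot y y -> nrm x <= nrm y.
Proof. by move=> xy; rewrite nrm_le ?nrm_ge0// sqr_nrm. Qed.

(** Cauchy-Schwarz from the triangle inequality, which is part of the normed structure: squaring
    [nrmD] bounds a nonnegative [rdot x y], and [- x] handles the other sign. *)
Lemma rdot_le x y : `|rdot x y| <= nrm x * nrm y.
Proof.
wlog: x y / 0 <= rdot x y => [wl|xy0].
  have [xy0|xy0] := leP 0 (rdot x y); first exact: wl.
  by rewrite -normrN -rdotNl -(nrmN x) wl// rdotNl oppr_ge0 ltW.
rewrite ger0_norm//.
have := nrmD x y; rewrite -(@ler_pXn2r _ 2)// ?nnegrE ?nrm_ge0 ?addr_ge0 ?nrm_ge0//.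
rewrite sqrrD !sqr_nrm !rdotE (rdotC y x).
set a := rdot x y; set b := nrm x * nrm y; rewrite mulr2n; lra.
Qed.

Lemma rdot_split (P : H -> H) x : rdot (P x) (x - P x) = 0 ->
  rdot x x = rdot (P x) (P x) + rdot (x - P x) (x - P x).
Proof. by rewrite !rdotE (rdotC x (P x)) => e; lra. Qed.

Lemma cvg_nrm (u : nat -> H) (l : H) :
  (forall e : R, 0 < e -> exists N, forall n, (N <= n)%N -> nrm (u n - l) < e) ->
  u @ \oo --> l.
Proof.
move=> h; apply/cvgrPdist_lt => e e0.
(* A positive element of [R[i]] is real, so the radius may be replaced by its real part. *)
have eE : e = (complex.Re e)%:C.
  by case: e e0 => a b; rewrite ltcE /= => /andP[/eqP-> _].
have [|N hN] := h (complex.Re e); first by rewrite -ltcR -eE.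
by exists N => // n Nn; rewrite normE eE ltcR nrmBC hN.
Qed.

Lemma nrm_cvg (u : nat -> H) (l : H) : u @ \oo --> l ->
  forall e : R, 0 < e -> exists N, forall n, (N <= n)%N -> nrm (u n - l) < e.
Proof.
move=> /cvgrPdist_lt h e e0.
have [|N _ hN] := h e%:C; first by rewrite ltcR.
by exists N => n Nn; have := hN n Nn; rewrite normE ltcR nrmBC.
Qed.

Lemma nrm_cauchy (u : nat -> H) :
  (forall e : R, 0 < e -> exists N, forall n, (N <= n)%N -> nrm (u n - u N) < e) ->
  exists l : H, u @ \oo --> l.
Proof.
move=> h; suff : cvg (u @ \oo) by move=> /cvg_ex[l ul]; exists l.
apply: cauchy_cvg; apply: cauchy_exP => e e0.
have eE : e = (complex.Re e)%:C.
  by case: e e0 => a b; rewrite ltcE /= => /andP[/eqP-> _].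
have [|N hN] := h (complex.Re e); first by rewrite -ltcR -eE.
exists (u N); exists N => // n Nn.
by rewrite /= -ball_normE /= normE nrmBC eE ltcR hN.
Qed.

Lemma cvg_rdot (u v : nat -> H) (l m : H) : u @ \oo --> l -> v @ \oo --> m ->
  (fun n => rdot (u n) (v n)) @ \oo --> rdot l m.
Proof.
move=> ul vm; apply/cvgrPdist_lt => e e0.
pose M := nrm l + nrm m + 1.
have M0 : 0 < M by rewrite /M; have := nrm_ge0 l; have := nrm_ge0 m; lra.
(* As [d <= 1], the three error terms below add up to at most [d * M], hence to at most [e / 2]. *)
pose d := Num.min 1 (e / (2 * M)).
have d0 : 0 < d by rewrite lt_min ltr01 divr_gt0// mulr_gt0.
have d1 : d <= 1 by rewrite /d ge_min lexx.
have dM : d * (2 * M) <= e.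
  by rewrite -ler_pdivlMr ?mulr_gt0// /d ge_min lexx orbT.
have [N1 h1] := nrm_cvg ul d0.
have [N2 h2] := nrm_cvg vm d0.
exists (maxn N1 N2) => // n /=; rewrite geq_max => /andP[/h1 {}h1 /h2 {}h2].
have -> : rdot l m - rdot (u n) (v n) =
    - (rdot (u n - l) (v n - m) + rdot (u n - l) m + rdot l (v n - m)).
  by rewrite !rdotE; ring.
rewrite normrN; apply: le_lt_trans (ler_normD _ _) _.
have := ler_normD (rdot (u n - l) (v n - m)) (rdot (u n - l) m).
have := rdot_le (u n - l) (v n - m).
have := rdot_le (u n - l) m.
have := rdot_le l (v n - m).
have := nrm_ge0 (u n - l); have := nrm_ge0 (v n - m).
have := nrm_ge0 l; have := nrm_ge0 m.
move: h1 h2 dM; rewrite /M.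
move: (nrm _) (nrm _) (nrm _) (nrm _) `|_| `|_| `|_| `|_| => a b c f p q s t.
nra.
Qed.

Lemma cvgH_unique (u : nat -> H) (l m : H) : u @ \oo --> l -> u @ \oo --> m -> l = m.
Proof. by move=> ul um; apply: (norm_cvg_unique ul um). Qed.

Lemma cvg_limit_ext (u v : nat -> H) (l : H) : u @ \oo --> l -> u =1 v ->
  v @ \oo --> l.
Proof. by move=> ul /funext <-. Qed.

End real_inner_product.

Section bounded_operators.
Context (R : realType) (H : hilbertType R).
Implicit Types (A B : H -> H) (x y z : H) (r : R).

Section linear.
Context A (linA : linear A).

Lemma linop0 : A 0 = 0.
Proof. by have := linA (-1) 0 0; rewrite scaler0 addr0 scaleN1r addNr. Qed.

Lemma linopD x y : A (x + y) = A x + A y.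
Proof. by have := linA 1 x y; rewrite !scale1r. Qed.

Lemma linopZ (a : R[i]) x : A (a *: x) = a *: A x.
Proof. by have := linA a x 0; rewrite !addr0 linop0 addr0. Qed.

Lemma linopN x : A (- x) = - A x.
Proof. by rewrite -scaleN1r linopZ scaleN1r. Qed.

Lemma linopB x y : A (x - y) = A x - A y.
Proof. by rewrite linopD linopN. Qed.

Lemma linop_sum n (v : 'I_n -> H) : A (\sum_i v i) = \sum_i A (v i).
Proof.
elim: n v => [|n IH] v; first by rewrite !big_ord0 linop0.
by rewrite !big_ord_recl linopD IH.
Qed.

End linear.

Lemma bounded_operator_nrm A : bounded_operator A ->
  exists2 M : R, 0 <= M & forall x, nrm (A x) <= M * nrm x.
Proof.
move=> [_ [M hM]]; exists `|complex.Re M| => // x.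
have := hM x; rewrite !normE lecE => /andP[_] /=.
case: M hM => a b hM /=; rewrite mulr0 subr0 => h.
by apply: le_trans h _; rewrite ler_wpM2r ?nrm_ge0// ler_norm.
Qed.

Lemma nrm_bounded_operator A M : linear A -> (forall x, nrm (A x) <= M * nrm x) ->
  bounded_operator A.
Proof.
move=> linA hM; split=> //; exists M%:C => x.
by rewrite !normE -rmorphM lecR.
Qed.

Lemma bounded_operator_cvg A (u : nat -> H) (l : H) : bounded_operator A ->
  u @ \oo --> l -> (fun n => A (u n)) @ \oo --> A l.
Proof.
move=> bA ul; have [M M0 hM] := bounded_operator_nrm bA; case: bA => linA _.
apply: cvg_nrm => e e0.
have M1 : 0 < M + 1 by lra.
have [N hN] := nrm_cvg ul (divr_gt0 e0 M1).
exists N => n /hN; rewrite ltr_pdivlMr// -linopB// => h.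
apply: le_lt_trans (hM _) _.
by have := nrm_ge0 (u n - l); move: (nrm _) h => a; nra.
Qed.

Definition rsym A := forall x y, rdot (A x) y = rdot x (A y).

(** Testing symmetry at ['i *: x] as well recovers the imaginary parts. *)
Lemma rsym_dotp A : linear A -> rsym A ->
  forall x y, dotp (A x) y = dotp x (A y).
Proof.
move=> linA sA x y.
have h1 := sA x y.
have h2 := sA ('i *: x) y.
move: h1 h2; rewrite /rdot linopZ// !dotpZl.
case: (dotp (A x) y) => a b; case: (dotp x (A y)) => c d /= ->.
by rewrite !mul0r !mul1r !sub0r => /oppr_inj ->.
Qed.

(** Complex polarization: the order of [R[i]] makes the form real on the diagonal, and its vanishing
    imaginary part at [x + 'i *: y] is the symmetry relation. *)
Lemma ge0_rsym A : linear A -> op_le (cst 0) A -> rsym A.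
Proof.
move=> linA A0 x y.
have im0 z : complex.Im (dotp (A z) z) = 0.
  have := A0 z; rewrite lecE => /andP[/eqP -> _].
  by rewrite dotp0l.
have := im0 (x + 'i *: y).
rewrite linopD// linopZ// dotpDl dotpZl.
rewrite (dotpC (A x)) (dotpC (A y)) !dotpDl !dotpZl !rmorphD/= !rmorphM/=.
rewrite -!dotpC.
have := im0 x; have := im0 y.
rewrite /rdot (dotpC x (A y)).
case: (dotp (A y) y) => a b; case: (dotp (A x) y) => c d.
case: (dotp (A y) x) => e f; case: (dotp (A x) x) => g h /= -> ->; lra.
Qed.

Lemma op_le_rdot A B : op_le A B -> forall x, rdot (A x) x <= rdot (B x) x.
Proof. by move=> AB x; have := AB x; rewrite lecE => /andP[]. Qed.

Lemma rdot_op_ge0 A : linear A -> rsym A ->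
  (forall x, 0 <= rdot (A x) x) -> op_le (cst 0) A.
Proof.
move=> linA sA A0 x.
have := rsym_dotp linA sA x x; have := A0 x.
rewrite dotp0l lecE /rdot /=.
rewrite (dotpC x (A x)); case: (dotp (A x) x) => a b /= -> [] h.
by rewrite andbT; apply/eqP; lra.
Qed.

Lemma rsym_form_eq A B : linear A -> linear B -> rsym A -> rsym B ->
  (forall x, rdot (A x) x = rdot (B x) x) -> A = B.
Proof.
move=> linA linB sA sB AB; apply/funext => x; apply: rdot_eq => y.
have := AB (x + y).
rewrite !linopD// !rdotE !AB (sA y x) (sB y x) (rdotC y) (rdotC y); lra.
Qed.

(* If [0 <= A <= c] then [A (c - A) >= 0], since
   [c * A (c - A) = A (c - A)^2 + A^2 (c - A)]. *)
Lemma rdot_sqr_le A (c : R) x : linear A -> rsym A -> 0 < c ->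
  0 <= rdot (A (c%:C *: x - A x)) (c%:C *: x - A x) ->
  rdot (A (A x)) (A x) <= c * rdot (A x) (A x) ->
  rdot (A x) (A x) <= c * rdot (A x) x.
Proof.
move=> linA sA c0; rewrite (linopB linA) (linopZ linA) !rdotE (sA (A x) x).
move=> h1 h2; rewrite -(@ler_pM2l _ c)//; lra.
Qed.

End bounded_operators.

(** * Polynomials in a positive contraction *)

Section polynomial_calculus.
Context (R : realType) (H : hilbertType R) (S : H -> H).
Hypotheses (linS : linear S) (symS : rsym S).
Hypotheses (S_ge0 : forall x, 0 <= rdot (S x) x).
Hypotheses (S_le1 : forall x, rdot (S x) x <= rdot x x).
Implicit Types (p q r : {poly R}) (x y z : H).

(** This is p(S) x. Real coefficients make p(S) symmetric. *)
Definition ev p x : H := \sum_(i < size p) (p`_i)%:C *: iter i S x.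

Lemma ev_widen n p x : (size p <= n)%N ->
  ev p x = \sum_(i < n) (p`_i)%:C *: iter i S x.
Proof.
move=> pn; rewrite /ev (big_ord_widen n (fun i => (p`_i)%:C *: iter i S x))//.
rewrite big_mkcond/=; apply: eq_bigr => i _; case: ltnP => // h.
by rewrite nth_default// scale0r.
Qed.

Lemma evD p q x : ev (p + q) x = ev p x + ev q x.
Proof.
pose n := maxn (size p) (size q).
rewrite !(@ev_widen n) ?size_polyD// ?leq_max ?leqnn ?orbT// -big_split.
by apply: eq_bigr => i _ /=; rewrite coefD rmorphD scalerDl.
Qed.

Lemma evC (c : R) x : ev c%:P x = c%:C *: x.
Proof. by rewrite (@ev_widen 1) ?size_polyC_leq1// big_ord1 coefC. Qed.

Lemma evCM (c : R) p x : ev (c%:P * p) x = c%:C *: ev p x.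
Proof.
rewrite (@ev_widen (size p)); last first.
  by rewrite mul_polyC size_scale_leq.
rewrite /ev scaler_sumr; apply: eq_bigr => i _.
by rewrite coefCM rmorphM scalerA.
Qed.

Lemma evXM p x : ev ('X * p) x = S (ev p x).
Proof.
rewrite (@ev_widen (size p).+1); last first.
  by rewrite (leq_trans (size_polyMleq _ _))// size_polyX.
rewrite big_ord_recl coefXM/= scale0r add0r /ev (linop_sum linS).
by apply: eq_bigr => i _; rewrite coefXM/= (linopZ linS).
Qed.

Lemma evM p q x : ev (p * q) x = ev p (ev q x).
Proof.
elim/poly_ind: p => [|p c IH]; first by rewrite mul0r -polyC0 !evC !scale0r.
have -> : (p * 'X + c%:P) * q = 'X * (p * q) + c%:P * q by ring.
by rewrite (mulrC p 'X) !evD !evXM evCM evC IH.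
Qed.

Lemma ev1 x : ev 1 x = x.
Proof. by rewrite -polyC1 evC scale1r. Qed.

Lemma evX x : ev 'X x = S x.
Proof. by rewrite -['X]mulr1 evXM ev1. Qed.

Lemma evN p x : ev (- p) x = - ev p x.
Proof. by rewrite -mulN1r -polyCN evCM rmorphN1 scaleN1r. Qed.

Lemma evB p q x : ev (p - q) x = ev p x - ev q x.
Proof. by rewrite evD evN. Qed.

Lemma ev_linear p : linear (ev p).
Proof.
move=> a x y; elim/poly_ind: p => [|p c IH].
  by rewrite -polyC0 !evC !scale0r scaler0 addr0.
rewrite mulrC !evD !evXM !evC IH linS !scalerDr !scalerA (mulrC a).
by rewrite addrACA.
Qed.

Lemma ev_sym p : rsym (ev p).
Proof.
move=> x y; elim/poly_ind: p x y => [|p c IH] x y.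
  by rewrite -polyC0 !evC !scale0r rdot0l rdot0r.
rewrite mulrC !evD !evXM !evC !rdotE symS IH.
by rewrite -evXM -evX -evM (mulrC p).
Qed.

Lemma ev_commute (K : H -> H) p : linear K -> (forall x, K (S x) = S (K x)) ->
  forall x, K (ev p x) = ev p (K x).
Proof.
move=> linK KS x; elim/poly_ind: p => [|p c IH].
  by rewrite -polyC0 !evC !scale0r (linop0 linK).
by rewrite mulrC !evD !evXM !evC (linopD linK) KS IH (linopZ linK).
Qed.

Definition pos p := forall x, 0 <= rdot (ev p x) x.

Lemma posD p q : pos p -> pos q -> pos (p + q).
Proof. by move=> hp hq x; rewrite evD rdotDl addr_ge0. Qed.

Lemma pos_sqrM p q : pos p -> pos (q ^+ 2 * p).
Proof.
move=> hp x; rewrite expr2 -mulrA (mulrC q p) evM ev_sym evM; exact: hp.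
Qed.

(** Positivity of [r] against all squarefree products of ['X] and [1 - 'X]. Repeated factors are
    squares, absorbed by [pos_sqrM], so multiplication by a generator preserves this. *)
Definition stable_pos r :=
  [/\ pos r, pos ('X * r), pos ((1 - 'X) * r) & pos ('X * (1 - 'X) * r)].

(* The preordering generated by ['X] and [1 - 'X]; unlike positivity, it is
   closed under products without further ado. *)
Definition spos p := forall r, stable_pos r -> stable_pos (p * r).

(** The bounds [0 <= S <= 1] enter here. The product of both generators is a sum of squares times
    single generators. *)
Lemma stable_pos1 : stable_pos 1.
Proof.
have p1 : pos 1 by move=> x; rewrite ev1 rdot_ge0.
have pX : pos 'X by move=> x; rewrite evX.
have pY : pos (1 - 'X) by move=> x; rewrite evB ev1 evX rdotBl subr_ge0.
split; rewrite ?mulr1//.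
have -> : 'X * (1 - 'X) = (1 - 'X) ^+ 2 * 'X + 'X ^+ 2 * (1 - 'X) :> {poly R}.
  by ring.
by apply: posD; apply: pos_sqrM.
Qed.

Lemma spos_pos p : spos p -> pos p.
Proof. by move=> /(_ _ stable_pos1)[]; rewrite mulr1. Qed.

Lemma sposM p q : spos p -> spos q -> spos (p * q).
Proof. by move=> hp hq r hr; rewrite -mulrA; apply/hp/hq. Qed.

Lemma sposD p q : spos p -> spos q -> spos (p + q).
Proof.
move=> hp hq r hr; have [a b c d] := hp r hr; have [a' b' c' d'] := hq r hr.
have e s : s * ((p + q) * r) = s * (p * r) + s * (q * r) by ring.
by split; rewrite ?e ?[(p + q) * r]mulrDl; apply: posD.
Qed.

Lemma spos_sqr q : spos (q ^+ 2).
Proof.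
move=> r [a b c d]; split; rewrite ?(mulrCA _ (q ^+ 2)); apply: pos_sqrM => //.
Qed.

Lemma sposC (c : R) : 0 <= c -> spos c%:P.
Proof. by move=> c0; rewrite -(sqr_sqrtr c0) rmorphXn; apply: spos_sqr. Qed.

Lemma spos1 : spos 1. Proof. by move=> r; rewrite mul1r. Qed.

Lemma sposX : spos 'X.
Proof.
move=> r [a b c d]; split=> //.
- by rewrite mulrA -expr2; apply: pos_sqrM.
- by rewrite mulrA (mulrC _ 'X).
- have -> : 'X * (1 - 'X) * ('X * r) = 'X ^+ 2 * ((1 - 'X) * r) by ring.
  exact: pos_sqrM.
Qed.

Lemma spos1X : spos (1 - 'X).
Proof.
move=> r [a b c d]; split=> //.
- by rewrite mulrA.
- by rewrite mulrA -expr2; apply: pos_sqrM.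
- have -> : 'X * (1 - 'X) * ((1 - 'X) * r) = (1 - 'X) ^+ 2 * ('X * r) by ring.
  exact: pos_sqrM.
Qed.

(** Lets the iterations below be handled through doubled terms, so that the identities to check are
    free of the constant 1/2. *)
Lemma spos_half p : spos (p + p) -> spos p.
Proof.
move=> hp; have -> : p = (2^-1)%:P * (p + p).
  have e : (2^-1 : R)%:P + (2^-1)%:P = 1 by rewrite -polyCD -polyC1; congr _%:P; lra.
  by rewrite mulrDr -mulrDl e mul1r.
by apply: sposM => //; apply: sposC; rewrite invr_ge0.
Qed.

(** The forms of [m n] at [x] increase and stay below [rdot x x], hence converge; their increments
    dominate the squared distances between the vectors [ev (p n) x], which are therefore Cauchy. *)
Lemma monotone_cauchy_cvg (p m : nat -> {poly R}) :
  (forall n k, (n <= k)%N -> pos (m k - m n - (p k - p n) ^+ 2)) ->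
  (forall n, pos (1 - m n)) ->
  exists J : H -> H, forall x, (fun n => ev (p n) x) @ \oo --> J x.
Proof.
move=> hpm m1.
suff /choice[J hJ] : forall x, exists l : H, (fun n => ev (p n) x) @ \oo --> l.
  by exists J.
move=> x; pose a n := rdot (ev (m n) x) x.
have pma n k : (n <= k)%N ->
    rdot (ev (p k) x - ev (p n) x) (ev (p k) x - ev (p n) x) <= a k - a n.
  move=> nk; have := hpm n k nk x.
  rewrite expr2 evB rdotBl evM (ev_sym (p k - p n)) 2!evB rdotBl.
  by rewrite -/(a n) -/(a k) subr_ge0.
have nda : nondecreasing_seq a.
  by move=> n k nk; have := pma _ _ nk; have := rdot_ge0 (ev (p k) x - ev (p n) x); lra.
have uba n : a n <= rdot x x.
  by have := m1 n x; rewrite evB ev1 rdotBl subr_ge0.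
have /cvgrPdist_lt ca : a @ \oo --> sup (range a).
  by apply: nondecreasing_cvgn => //; exists (rdot x x) => _ [n _ <-].
apply: nrm_cauchy => e e0.
have [|N _ hN] := ca (e ^+ 2 / 2); first by rewrite divr_gt0// exprn_gt0.
exists N => n Nn; rewrite -(@ltr_pXn2r _ 2)// ?nnegrE ?nrm_ge0 ?ltW// sqr_nrm.
apply: le_lt_trans (pma _ _ Nn) _.
have := hN n Nn; have := hN N (leqnn N).
by rewrite /= !ltr_norml => /andP[h1 h2] /andP[h3 h4]; lra.
Qed.

(** * Strong limits of contractive polynomials in [S] *)

Section strong_limit.
Context (p : nat -> {poly R}) (J : H -> H).
Hypotheses (p_contract : forall n, pos (1 - p n ^+ 2)).
Hypotheses (pJ : forall x, (fun n => ev (p n) x) @ \oo --> J x).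

Lemma ev_contract n x : nrm (ev (p n) x) <= nrm x.
Proof.
apply: nrm_rdot_le; have := p_contract n x.
by rewrite evB ev1 expr2 evM rdotBl ev_sym subr_ge0.
Qed.

Lemma slim_linear : linear J.
Proof.
move=> a x y.
have h : (fun n => a *: ev (p n) x + ev (p n) y) @ \oo --> a *: J x + J y.
  by apply: cvgD => //; apply: cvgZr.
have {}h : (fun n => ev (p n) (a *: x + y)) @ \oo --> a *: J x + J y.
  by apply: cvg_limit_ext h _ => n /=; rewrite ev_linear.
exact: (cvgH_unique (@pJ _) h).
Qed.

Lemma slim_sym : rsym J.
Proof.
move=> x y; have h1 : (fun n => rdot (ev (p n) x) y) @ \oo --> rdot (J x) y.
  by apply: cvg_rdot => //; apply: cvg_cst.
apply: (cvgR_unique h1).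
under [X in X @ _]eq_fun do rewrite ev_sym.
by apply: cvg_rdot => //; apply: cvg_cst.
Qed.

Lemma slim_contract x : nrm (J x) <= nrm x.
Proof.
apply: nrm_rdot_le; have h := cvg_rdot (@pJ x) (@pJ x).
apply: (cvgR_le h) => n /=; rewrite -!sqr_nrm.
by rewrite ler_pXn2r ?nnegrE ?nrm_ge0// ev_contract.
Qed.

Lemma slim_bounded : bounded_operator J.
Proof.
apply: (@nrm_bounded_operator _ _ _ 1); first exact: slim_linear.
by move=> x; rewrite mul1r slim_contract.
Qed.

Lemma slim_commute (K : H -> H) : bounded_operator K ->
  (forall x, K (S x) = S (K x)) -> forall x, K (J x) = J (K x).
Proof.
move=> bK KS x; have h := bounded_operator_cvg bK (@pJ x).
have {}h : (fun n => ev (p n) (K x)) @ \oo --> K (J x).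
  by apply: cvg_limit_ext h _ => n /=; apply: ev_commute => //; case: bK.
exact: (cvgH_unique h (@pJ _)).
Qed.

(** Uniform contractivity allows the operator and the vector to vary together: compare both sides
    with [ev (p n) l]. *)
Lemma slim_comp (u : nat -> H) (l : H) : u @ \oo --> l ->
  (fun n => ev (p n) (u n)) @ \oo --> J l.
Proof.
move=> ul; apply: cvg_nrm => e e0.
have e2 : 0 < e / 2 by rewrite divr_gt0.
have [N1 h1] := nrm_cvg ul e2; have [N2 h2] := nrm_cvg (@pJ l) e2.
exists (maxn N1 N2) => n; rewrite geq_max => /andP[/h1 {}h1 /h2 {}h2].
apply: le_lt_trans (nrmB _ (ev (p n) l) _) _.
rewrite -(linopB (ev_linear (p n))).
have := ev_contract n (u n - l); lra.
Qed.

Lemma slim_sqr x : (fun n => ev (p n ^+ 2) x) @ \oo --> J (J x).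
Proof. by apply: cvg_limit_ext (slim_comp (@pJ x)) _ => n /=; rewrite expr2 evM. Qed.

End strong_limit.

Lemma cvg_pos (q : nat -> {poly R}) x y : (forall n, pos (q n)) ->
  (fun n => ev (q n) x) @ \oo --> y -> 0 <= rdot y x.
Proof.
move=> hq h.
have {}h : (fun n => rdot (ev (q n) x) x) @ \oo --> rdot y x.
  by apply: cvg_rdot => //; apply: cvg_cst.
by apply: (cvgR_ge h) => n; apply: hq.
Qed.

(** [ev_contract] for the constant sequence ['X], since 1 - X^2 = (1 - X)(1 + X) lies in the
    preordering. *)
Lemma nrm_op_le x : nrm (S x) <= nrm x.
Proof.
have p1 n : pos (1 - (fun _ : nat => 'X) n ^+ 2).
  have -> : 1 - 'X ^+ 2 = (1 - 'X) * (1 + 'X) :> {poly R} by ring.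
  apply: spos_pos; apply: sposM spos1X _; exact: sposD spos1 sposX.
by have := ev_contract p1 0 x; rewrite evX.
Qed.

Lemma contraction_bounded : bounded_operator S.
Proof.
by apply: (@nrm_bounded_operator _ _ _ 1) => // x; rewrite mul1r nrm_op_le.
Qed.

Lemma spos_nondecreasing (u : nat -> {poly R}) :
  (forall n, spos (u n.+1 - u n)) ->
  forall n k, (n <= k)%N -> spos (u k - u n).
Proof.
move=> h n k /subnK <-; elim: (k - n)%N => [|m IH].
  by rewrite subrr -polyC0; apply: sposC.
have -> : u (m.+1 + n)%N - u n = (u (m + n).+1 - u (m + n)%N) + (u (m + n)%N - u n).
  by rewrite addSn; ring.
exact: sposD.
Qed.

(* [1 - sqrt p] is the increasing limit of [z_(n+1) = ((1 - p) + z_n^2) / 2]. *)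
Lemma poly_sqrt_op p : spos p -> spos (1 - p) -> exists B : H -> H,
  [/\ bounded_operator B, rsym B, forall x, 0 <= rdot (B x) x &
      forall x, B (B x) = ev p x].
Proof.
move=> p0 p1.
pose z n := iter n (fun w : {poly R} => (2^-1)%:P * ((1 - p) + w ^+ 2)) 0.
have zE n : z n.+1 + z n.+1 = (1 - p) + z n ^+ 2.
  rewrite /= -mulrDl -polyCD; have -> : 2^-1 + 2^-1 = 1 :> R by lra.
  by rewrite mul1r.
have z0 n : spos (z n).
  elim: n => [|n IH]; first exact: (sposC (lexx 0)).
  by apply: spos_half; rewrite zE; apply: sposD => //; apply: spos_sqr.
have z1 n : spos (1 - z n).
  elim: n => [|n IH]; first by rewrite subr0; apply: spos1.
  apply: spos_half.
  have -> : 1 - z n.+1 + (1 - z n.+1) = p + (1 - z n) * (1 + z n).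
    by rewrite addrACA -opprD zE; ring.
  by apply: sposD => //; apply: sposM => //; apply: sposD => //; apply: spos1.
(* Twice the next increment is [(z n.+1 - z n) * (z n.+1 + z n)], so closure of [spos] under
   products carries the induction. *)
have zS n : spos (z n.+1 - z n).
  elim: n => [|n IH]; first by rewrite subr0.
  apply: spos_half.
  have -> : z n.+2 - z n.+1 + (z n.+2 - z n.+1) = (z n.+1 - z n) * (z n.+1 + z n).
    by rewrite addrACA -opprD !zE; ring.
  by apply: sposM => //; apply: sposD.
have znd := spos_nondecreasing zS.
have zsq n : pos (1 - z n ^+ 2).
  have -> : 1 - z n ^+ 2 = (1 - z n) * (1 + z n) by ring.
  by apply: spos_pos; apply: sposM => //; apply: sposD => //; apply: spos1.
have [n k nk|n|J zJ] := @monotone_cauchy_cvg z z.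
- have -> : z k - z n - (z k - z n) ^+ 2 = (z k - z n) * ((1 - z k) + z n) by ring.
  by apply: spos_pos; apply: sposM; [apply: znd|apply: sposD].
- exact: spos_pos.
have linJ := slim_linear zJ.
have JE x : J x + J x = x - ev p x + J (J x).
  have h1 : (fun n => ev (1 - p + z n ^+ 2) x) @ \oo --> x - ev p x + J (J x).
    apply: (@cvg_limit_ext _ _ (fun n => (x - ev p x) + ev (z n ^+ 2) x)).
      by apply: cvgD; [exact: cvg_cst|exact: slim_sqr].
    by move=> n; rewrite !evD evN ev1.
  have h2 : (fun n => ev (z n.+1 + z n.+1) x) @ \oo --> J x + J x.
    have h := zJ x; rewrite -cvg_shiftS in h.
    apply: (@cvg_limit_ext _ _ (fun n => ev (z n.+1) x + ev (z n.+1) x)).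
      by apply: cvgD.
    by move=> n; rewrite evD.
  apply: (cvgH_unique h2).
  by under [X in X @ _]eq_fun do rewrite zE.
(* The limit of the recursion is 2J = 1 - p + J^2, so (1 - J)^2 = 1 - 2J + J^2 = p. *)
exists (fun x => x - J x); split.
- apply: (@nrm_bounded_operator _ _ _ 2).
    by move=> a x y /=; rewrite linJ opprD addrACA scalerBr.
  move=> x; have := nrmD x (- J x); rewrite nrmN.
  have := slim_contract zsq zJ x; lra.
- by move=> x y; rewrite !rdotE (slim_sym zJ).
- move=> x; apply: (@cvg_pos (fun n => 1 - z n)) => [n|]; first exact: spos_pos.
  apply: (@cvg_limit_ext _ _ (fun n => x - ev (z n) x)).
    by apply: cvgB; [exact: cvg_cst|exact: zJ].
  by move=> n; rewrite evB ev1.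
- move=> x; rewrite (linopB linJ) opprB addrA.
  have -> : x - J x + J (J x) - J x = x + J (J x) - (J x + J x).
    by rewrite opprD addrA (addrAC x).
  by rewrite JE opprD opprB addrACA subrr addr0 addrC subrK.
Qed.

(** * The spectral projection for a half-line []t, +oo[] *)

Section spectral_cut.
Variable t : R.
(** For s in [0, 1] one has |s - t| <= 1 + |t|, so this factor brings [X] into [-1, 1]. *)
Let c : R := (1 + `|t|)^-1.
Let X : {poly R} := c%:P * ('X - t%:P).

Let c_gt0 : 0 < c.
Proof. by rewrite invr_gt0 ltr_wpDr. Qed.

Let evXt x : ev X x = c%:C *: (S x - t%:C *: x).
Proof. by rewrite evCM evB evX evC. Qed.

(* The Newton-Schulz iteration [s -> s (3 - s^2) / 2] started at [X], with
   [s_n = X g_n]; it converges to the sign of [X]. *)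
Let g n := iter n (fun w : {poly R} => (2^-1)%:P * (w * (3%:R - (X * w) ^+ 2))) 1.
Let s n := X * g n.

Let gE n : g n.+1 + g n.+1 = g n * (3%:R - s n ^+ 2).
Proof.
rewrite /= -mulrDl -polyCD; have -> : 2^-1 + 2^-1 = 1 :> R by lra.
by rewrite mul1r.
Qed.

Let sE n : s n.+1 + s n.+1 = s n * (3%:R - s n ^+ 2).
Proof. by rewrite /s -mulrDr gE mulrA. Qed.

(** The iteration preserves [-1, 1] because 2 + s (3 - s^2) = (1 + s)^2 (2 - s), and likewise with
    [- s]. *)
Let s_bound n : spos (1 + s n) /\ spos (1 - s n).
Proof.
elim: n => [|n [IH1 IH2]].
  have cE : 1 = c%:P * (1 + `|t|)%:P :> {poly R}.
    by rewrite -polyCM mulVf// gt_eqF// ltr_wpDr.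
  rewrite /s /= mulr1 /X; split.
    rewrite [X in X + _]cE -mulrDr; apply: sposM; first exact/sposC/ltW.
    have -> : (1 + `|t|)%:P + ('X - t%:P) = (1 + `|t| - t)%:P + 'X.
      by rewrite polyCB; ring.
    apply: sposD sposX; apply: sposC; have := ler_norm t; lra.
  rewrite [X in X - _]cE -mulrBr; apply: sposM; first exact/sposC/ltW.
  have -> : (1 + `|t|)%:P - ('X - t%:P) = (`|t| + t)%:P + (1 - 'X).
    by rewrite !polyCD polyC1; ring.
  apply: sposD spos1X; apply: sposC; have := ler_norm (- t); rewrite normrN; lra.
have h1 : spos (1 + (1 - s n)) by apply: sposD => //; apply: spos1.
have h2 : spos (1 + (1 + s n)) by apply: sposD => //; apply: spos1.
split; apply: spos_half.
- have -> : 1 + s n.+1 + (1 + s n.+1) = (1 + s n) ^+ 2 * (1 + (1 - s n)).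
    by rewrite addrACA sE; ring.
  by apply: sposM => //; apply: spos_sqr.
- have -> : 1 - s n.+1 + (1 - s n.+1) = (1 - s n) ^+ 2 * (1 + (1 + s n)).
    by rewrite addrACA -opprD sE; ring.
  by apply: sposM => //; apply: spos_sqr.
Qed.

Let s_sqr n : spos (1 - s n ^+ 2).
Proof.
have -> : 1 - s n ^+ 2 = (1 + s n) * (1 - s n) by ring.
by have [] := s_bound n; apply: sposM.
Qed.

Let g_pos n : spos (g n).
Proof.
elim: n => [|n IH]; first exact: spos1.
apply: spos_half; rewrite gE; apply: sposM => //.
have -> : 3%:R - s n ^+ 2 = 1 + (1 + (1 - s n ^+ 2)) by ring.
by do 2 (apply: sposD; first exact: spos1).
Qed.

(** Monotonicity is stated for [g], as [s n = X * g n] changes sign with [X]. Twice the increment is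
    [g n * (1 - s n ^+ 2)]. *)
Let g_nd n k : (n <= k)%N -> spos (g k - g n).
Proof.
apply: spos_nondecreasing => {n k} n; apply: spos_half.
have -> : g n.+1 - g n + (g n.+1 - g n) = g n * (1 - s n ^+ 2).
  by rewrite addrACA gE; ring.
exact: sposM.
Qed.

(** With J the strong limit of [s n], that is sgn X, take P = (J + J^2) / 2. The last clause puts
    the range of [P] in the closure of the range of [S - t]; right continuity of the resolution of
    the identity will come from it. *)
Lemma spectral_cut : exists P : H -> H,
  [/\ [/\ bounded_operator P, rsym P & forall x, P (P x) = P x],
      forall K : H -> H, bounded_operator K -> (forall x, K (S x) = S (K x)) ->
        forall x, K (P x) = P (K x),
      (forall x, t * rdot (P x) (P x) <= rdot (S (P x)) (P x)) /\
      (forall x, rdot (S (x - P x)) (x - P x) <= t * rdot (x - P x) (x - P x))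
    & forall x (e : R), 0 < e -> exists v, nrm (P x - (S v - t%:C *: v)) < e].
Proof.
have [n k nk|n|J sJ] := @monotone_cauchy_cvg s (fun n => s n ^+ 2).
(* The left side is 2 s_n (s_k - s_n), where the two factors [X] combine into a square. *)
- have -> : s k ^+ 2 - s n ^+ 2 - (s k - s n) ^+ 2 =
      X ^+ 2 * (g n * (g k - g n) + g n * (g k - g n)) by rewrite /s; ring.
  apply: spos_pos; apply: sposM; first exact: spos_sqr.
  by have h := g_nd nk; apply: sposD; apply: sposM.
- exact: spos_pos.
have s1 n : pos (1 - s n ^+ 2) by exact: spos_pos.
have linJ := slim_linear sJ.
have symJ := slim_sym sJ.
(* The recursion passes to the limit as 2J = 3J - J^3. *)
have JJJ x : J (J (J x)) = J x.
  have h1 : (fun n => ev (s n * (3%:R - s n ^+ 2)) x) @ \oo -->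
      J x + J x + J x - J (J (J x)).
    apply: (@cvg_limit_ext _ _ (fun n => (ev (s n) x + ev (s n) x + ev (s n) x)
        - ev (s n) (ev (s n ^+ 2) x))).
      apply: cvgB; first by apply: cvgD; first apply: cvgD.
      by apply: slim_comp => //; apply: slim_sqr.
    move=> n; have -> : s n * (3%:R - s n ^+ 2) = s n + s n + s n - s n * s n ^+ 2.
      by ring.
    by rewrite evB evM !evD.
  have h2 : (fun n => ev (s n.+1 + s n.+1) x) @ \oo --> J x + J x.
    have h := sJ x; rewrite -cvg_shiftS in h.
    apply: (@cvg_limit_ext _ _ (fun n => ev (s n.+1) x + ev (s n.+1) x)).
      by apply: cvgD.
    by move=> n; rewrite evD.
  have {}h1 : (fun n => ev (s n.+1 + s n.+1) x) @ \oo -->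
      J x + J x + J x - J (J (J x)).
    by under [X in X @ _]eq_fun do rewrite sE.
  have e := cvgH_unique h2 h1; apply/esym/subr0_eq/(@addrI _ (J x + J x)).
  by rewrite addr0 addrA -e.
have SJ x : S (J x) = J (S x).
  by apply: (slim_commute sJ) => //; apply: contraction_bounded.
have JX x : J (ev X x) = ev X (J x).
  by rewrite !evXt (linopZ linJ) (linopB linJ) (linopZ linJ) SJ.
(* As [g 0 = 1] and [g] increases, [s n * X] dominates [X ^+ 2]; so the squared norm of [ev X x] is
   at most [rdot (ev X x) (ev (s n) x)], which tends to 0. *)
have Jker x : J x = 0 -> ev X x = 0.
  move=> Jx0; apply: rdot_eq0; apply/eqP; rewrite eq_le rdot_ge0 andbT.
  have h : (fun n => rdot (ev X x) (ev (s n) x)) @ \oo --> rdot (ev X x) 0.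
    by rewrite -Jx0; apply: cvg_rdot => //; apply: cvg_cst.
  rewrite rdot0r in h; apply: (cvgR_ge h) => n.
  rewrite -subr_ge0 -rdotBr -evB -ev_sym -evM.
  have -> : (s n - X) * X = X ^+ 2 * (g n - g 0) by rewrite /s /=; ring.
  by apply: spos_pos; apply: sposM; [apply: spos_sqr|apply: g_nd].
have JJX x : J (J (ev X x)) = ev X x.
  have /Jker : J (x - J (J x)) = 0 by rewrite (linopB linJ) JJJ subrr.
  by rewrite (linopB (ev_linear X)) -!JX => /eqP; rewrite subr_eq0 => /eqP.
(* This and [JX_neg] are the positivity of twice the positive and negative parts of X, using J X =
   |X| and J^2 X = X. *)
have JX_pos x : 0 <= rdot (J (ev X x) + J (J (ev X x))) x.
  apply: (@cvg_pos (fun n => (s n + s n ^+ 2) * X)) => [n|].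
    have -> : (s n + s n ^+ 2) * X = X ^+ 2 * (g n * (1 + s n)) by rewrite /s; ring.
    apply: spos_pos; apply: sposM; first exact: spos_sqr.
    by have [? ?] := s_bound n; apply: sposM.
  apply: (@cvg_limit_ext _ _ (fun n => ev (s n) (ev X x) + ev (s n ^+ 2) (ev X x))).
    by apply: cvgD => //; apply: slim_sqr.
  by move=> n; rewrite evM evD.
have JX_neg x : 0 <= rdot (J (ev X x) - J (J (ev X x))) x.
  apply: (@cvg_pos (fun n => (s n - s n ^+ 2) * X)) => [n|].
    have -> : (s n - s n ^+ 2) * X = X ^+ 2 * (g n * (1 - s n)) by rewrite /s; ring.
    apply: spos_pos; apply: sposM; first exact: spos_sqr.
    by have [? ?] := s_bound n; apply: sposM.
  apply: (@cvg_limit_ext _ _ (fun n => ev (s n) (ev X x) - ev (s n ^+ 2) (ev X x))).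
    by apply: cvgB => //; apply: slim_sqr.
  by move=> n; rewrite evM evB.
(* The map s -> (s + s^2) / 2 sends -1 and 0 to 0 and 1 to 1; the kernel of X is excluded, in
   accordance with the open endpoint [t]. *)
pose P x := (2^-1)%:C *: (J x + J (J x)).
have half y : (2^-1)%:C *: (y + y) = y.
  rewrite scalerDr -scalerDl -rmorphD; have -> : 2^-1 + 2^-1 = 1 :> R by lra.
  by rewrite scale1r.
have linP : linear P.
  move=> a x y; rewrite /P !linJ !scalerDr !scalerA (mulrC a).
  by rewrite addrACA.
have symP : rsym P by move=> x y; rewrite /P !rdotE !symJ.
have JP x : J (P x) = P x.
  by rewrite /P (linopZ linJ) (linopD linJ) JJJ addrC.
have PP x : P (P x) = P x by rewrite {1}/P !JP half.
have PX x : P (ev X x) = ev X (P x).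
  by rewrite evXt (linopZ linP) (linopB linP) (linopZ linP) evXt /P (linopZ linS)
    (linopD linS) !SJ.
have cXt x : rdot (S x) x - t * rdot x x = c^-1 * rdot (ev X x) x.
  by rewrite evXt !rdotE mulrA mulVf ?mul1r// gt_eqF.
exists P; split.
- split=> //; apply: (@nrm_bounded_operator _ _ _ 1) => // x; rewrite mul1r.
  apply: nrm_rdot_le.
  have e : rdot (P x) (x - P x) = 0 by rewrite rdotBr -symP symP PP symP subrr.
  by rewrite [leRHS](rdot_split e) lerDl rdot_ge0.
- move=> K bK KS x; have linK : linear K by case: bK.
  by rewrite /P (linopZ linK) (linopD linK) !(slim_commute sJ bK KS).
- split=> x.
    rewrite -subr_ge0 cXt; apply: mulr_ge0; first by rewrite invr_ge0 ltW.
    rewrite -PX symP PP -symP /P rdotZl mulr_ge0// ?invr_ge0//.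
  rewrite -subr_le0 cXt pmulr_rle0 ?invr_gt0//.
  have -> : rdot (ev X (x - P x)) (x - P x) = rdot (ev X x - P (ev X x)) x.
    rewrite (linopB (ev_linear X)) -PX rdotBr -[rdot _ (P x)]symP.
    by rewrite (linopB linP) PP subrr rdot0l subr0.
  have -> : ev X x - P (ev X x) =
      - ((2^-1)%:C *: (J (ev X x) - J (J (ev X x)))).
    rewrite /P -{1}(half (ev X x)) JJX -scalerBr -scalerN opprB.
    by rewrite opprD [- _ - _]addrC addrACA subrr add0r.
  by rewrite rdotNl rdotZl oppr_le0 mulr_ge0// invr_ge0.
(* [P x = J (P x)] is the limit of [ev (s n) (P x)], and [s n = X * g n] puts these vectors in the
   range of [S - t]. *)
- move=> x e e0; have [N hN] := nrm_cvg (@sJ (P x)) e0.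
  exists (c%:C *: ev (g N) (P x)).
  have := hN N (leqnn N); rewrite JP nrmBC /s evM evXt.
  by rewrite (linopZ linS) scalerA mulrC -scalerA -scalerBr.
Qed.
End spectral_cut.

End polynomial_calculus.

(** * From scalar measures to projections *)

Section projections.
Context (R : realType) (H : hilbertType R).
Implicit Types (P : H -> H) (x y : H).

Definition isproj P := [/\ linear P, rsym P & forall x, P (P x) = P x].

Lemma rdot_proj P x : isproj P -> rdot (P x) x = rdot (P x) (P x).
Proof. by move=> [_ sP PP]; rewrite !sP PP. Qed.

Lemma proj_orth P x : isproj P -> rdot (P x) (x - P x) = 0.
Proof. by move=> hP; rewrite rdotBr (rdot_proj x hP) subrr. Qed.

Lemma rdot_proj_le P x : isproj P -> rdot (P x) x <= rdot x x.
Proof.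
move=> hP; rewrite [leRHS](rdot_split (proj_orth x hP)) rdot_proj// lerDl.
exact: rdot_ge0.
Qed.

Lemma isproj_orthogonal P : isproj P -> orthogonal_projection P.
Proof.
move=> hP; have [lP sP PP] := hP; split; last exact: rsym_dotp.
  apply: (@nrm_bounded_operator _ _ _ 1) => // x; rewrite mul1r.
  by apply: nrm_rdot_le; rewrite -rdot_proj// rdot_proj_le.
exact/funext.
Qed.

Lemma orthogonal_isproj P : orthogonal_projection P -> isproj P.
Proof.
move=> [[lP _] PP sP]; split=> //; first by move=> x y; rewrite /rdot sP.
by move=> x; rewrite -[in RHS]PP.
Qed.

Lemma isproj_compl P : isproj P -> isproj (fun x => x - P x).
Proof.
move=> [lP sP PP]; split=> [a x y|x y|x].
- by rewrite lP opprD addrACA scalerBr.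
- by rewrite !rdotE sP.
- by rewrite (linopB lP) PP subrr subr0.
Qed.

Lemma isproj0 : isproj (fun=> 0).
Proof.
by split=> // [a x y|x y]; rewrite ?rdot0l ?rdot0r// scaler0 addr0.
Qed.

Lemma isproj_id : isproj id.
Proof. by []. Qed.

Lemma isproj_sub P1 P2 : isproj P1 -> isproj P2 ->
  (forall x, P1 (P2 x) = P2 x) -> isproj (fun x => P1 x - P2 x).
Proof.
move=> [l1 s1 PP1] [l2 s2 PP2] P12.
have P21 x : P2 (P1 x) = P2 x.
  by apply: rdot_eq => y; rewrite s2 s1 P12 s2.
split=> [a x y|x y|x].
- by rewrite l1 l2 opprD addrACA scalerBr.
- by rewrite !rdotE s1 s2.
- by rewrite (linopB l1) (linopB l2) PP1 PP2 P12 P21 subrr subr0.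
Qed.

(** At [P2 x] the bound leaves no room for [P1]. *)
Lemma orthogonal_projP P1 P2 : isproj P1 -> isproj P2 ->
  (forall x, rdot (P1 x) x + rdot (P2 x) x <= rdot x x) ->
  forall x, P1 (P2 x) = 0.
Proof.
move=> h1 [l2 s2 PP2] h x; apply: rdot_eq0; apply/eqP.
rewrite eq_le rdot_ge0 andbT -rdot_proj//.
by have := h (P2 x); rewrite PP2 gerDr.
Qed.

(** The partial sums are increasing projections, so squared distances between them are differences
    of a bounded monotone real sequence. *)
Lemma sum_proj (P : nat -> H -> H) : (forall n, isproj (P n)) ->
  (forall i j, i != j -> forall x, P i (P j x) = 0) ->
  exists2 Q, isproj Q &
    forall x, (fun n => \sum_(0 <= k < n) P k x) @ \oo --> Q x.
Proof.
move=> hP oP; pose s n x := \sum_(0 <= k < n) P k x.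
have sS n x : s n.+1 x = s n x + P n x by rewrite /s big_nat_recr.
have s0 x : s 0%N x = 0 by rewrite /s big_nil.
have lins n : linear (s n).
  elim: n => [|n IH] a x y; first by rewrite !s0 scaler0 addr0.
  by have [lP _ _] := hP n; rewrite !sS IH lP addrACA scalerDr.
have syms n : rsym (s n).
  elim: n => [|n IH] x y; first by rewrite !s0 rdot0l rdot0r.
  by have [_ sP _] := hP n; rewrite !sS !rdotE IH sP.
have Ps i n x : (n <= i)%N -> P i (s n x) = 0.
  have [lP _ _] := hP i; elim: n => [|n IH] ni; first by rewrite s0 (linop0 lP).
  by rewrite sS (linopD lP) IH ?(ltnW ni)// oP ?addr0// gtn_eqF.
have sP i n x : (n <= i)%N -> s n (P i x) = 0.
  elim: n => [|n IH] ni; first by rewrite s0.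
  by rewrite sS IH ?(ltnW ni)// oP ?addr0// ltn_eqF.
have ss n m x : (m <= n)%N -> s n (s m x) = s m x.
  move=> /subnK <-; elim: (n - m)%N => [|k IH].
    rewrite add0n; elim: m => [|m IH]; first by rewrite !s0.
    have [lPm _ PP] := hP m.
    by rewrite !sS (linopD (lins m)) IH sP// addr0 (linopD lPm) Ps// PP add0r.
  by rewrite addSn sS IH Ps ?addr0// leq_addl.
have hs n : isproj (s n) by split=> // x; apply: ss.
have dist n m x : (m <= n)%N -> rdot (s n x - s m x) (s n x - s m x) =
    rdot (s n x) x - rdot (s m x) x.
  move=> mn; rewrite !rdotE (rdotC (s m x) (s n x)) (syms n x (s m x)) (ss _ _ _ mn).
  by rewrite -!rdot_proj// (rdotC x); ring.
suff /choice[Q hQ] : forall x, exists l : H, (fun n => s n x) @ \oo --> l.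
  exists Q => //.
  have symQ x y : rdot (Q x) y = rdot x (Q y).
    have h1 : (fun n => rdot (s n x) y) @ \oo --> rdot (Q x) y.
      by apply: cvg_rdot => //; apply: cvg_cst.
    apply: (cvgR_unique h1); under [X in X @ _]eq_fun do rewrite syms.
    by apply: cvg_rdot => //; apply: cvg_cst.
  split=> //.
  - move=> a x y.
    have h : (fun n => a *: s n x + s n y) @ \oo --> a *: Q x + Q y.
      by apply: cvgD => //; apply: cvgZr.
    have {}h : (fun n => s n (a *: x + y)) @ \oo --> a *: Q x + Q y.
      by apply: cvg_limit_ext h _ => n /=; rewrite lins.
    exact: (cvgH_unique (@hQ _) h).
  - move=> x; apply: rdot_eq => y; rewrite symQ.
    have h1 : (fun n => rdot (s n x) (s n y)) @ \oo --> rdot (Q x) (Q y).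
      exact: cvg_rdot.
    apply: (cvgR_unique h1).
    under [X in X @ _]eq_fun do rewrite -syms (ss _ _ _ (leqnn _)).
    by apply: cvg_rdot => //; apply: cvg_cst.
move=> x; pose a n := rdot (s n x) x.
have nda : nondecreasing_seq a.
  by move=> m n mn; rewrite -subr_ge0 /a -dist// rdot_ge0.
have /cvgrPdist_lt ca : a @ \oo --> sup (range a).
  apply: nondecreasing_cvgn => //; exists (rdot x x) => _ [n _ <-].
  exact: rdot_proj_le.
apply: nrm_cauchy => e e0.
have [|N _ hN] := ca (e ^+ 2 / 2); first by rewrite divr_gt0// exprn_gt0.
exists N => n Nn; rewrite -(@ltr_pXn2r _ 2)// ?nnegrE ?nrm_ge0 ?ltW// sqr_nrm.
rewrite dist// -/(a n) -/(a N).
have := hN n Nn; have := hN N (leqnn N).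
by rewrite /= !ltr_norml => /andP[h1 h2] /andP[h3 h4]; lra.
Qed.

End projections.

(** * Projections represented by a family of scalar measures *)

Section spectral_family.
Context (R : realType) (H : hilbertType R).
Context (mu : H -> {measure set R -> \bar R}).
Hypothesis muT : forall x, mu x setT = (rdot x x)%:E.

Definition represents (P : H -> H) (B : set R) :=
  isproj P /\ forall x, mu x B = (rdot (P x) x)%:E.

Lemma represents_unique P P' B : represents P B -> represents P' B -> P = P'.
Proof.
move=> [[lP sP PP] hP] [[lP' sP' PP'] hP']; apply: rsym_form_eq => // x.
by apply: EFin_inj; rewrite -hP -hP'.
Qed.

(** Additivity and the total mass [rdot x x] give the bound required by [orthogonal_projP]. *)
Lemma represents_disjoint P P' A B : measurable A -> measurable B ->
  represents P A -> represents P' B -> A `&` B = set0 ->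
  forall x, P (P' x) = 0.
Proof.
move=> mA mB [hP PA] [hP' PB] AB; apply: orthogonal_projP => // x.
rewrite -lee_fin EFinD -PA -PB -measureU// -muT le_measure ?inE//.
exact: measurableU.
Qed.

Lemma represents_bigcup (F : (set R)^nat) (P : nat -> H -> H) :
  (forall k, measurable (F k)) -> trivIset setT F ->
  (forall k, represents (P k) (F k)) ->
  exists2 Q, represents Q (\bigcup_k F k) &
    forall x, (fun n => \sum_(0 <= k < n) P k x) @ \oo --> Q x.
Proof.
move=> mF tF hP.
have [n|i j ij x|Q pQ hQ] := @sum_proj _ _ P.
- by case: (hP n).
- apply: (represents_disjoint (mF i) (mF j) (hP i) (hP j)).
  by move/trivIsetP : tF; apply.
exists Q => //; split=> // x.
have h1 : (fun n => \sum_(0 <= k < n) mu x (F k))%E @ \oo --> mu x (\bigcup_k F k).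
  by apply: measure_semi_sigma_additive => //; apply: bigcupT_measurable.
have h2 : (fun n => (rdot (\sum_(0 <= k < n) P k x) x)%:E) @ \oo --> (rdot (Q x) x)%:E.
  apply: cvg_EFin; first exact: nearW.
  by apply: cvg_rdot => //; apply: cvg_cst.
apply: (cvg_unique _ h1); first exact: ereal_hausdorff.
apply: cvg_trans h2; apply: near_eq_cvg; apply: nearW => n /=.
elim: n => [|n IH]; first by rewrite !big_nil rdot0l.
by rewrite !big_nat_recr//= rdotDl EFinD IH; case: (hP n) => _ ->.
Qed.

Hypothesis mu_oc : forall a b : R, exists P, represents P `]a, b]%classic.

Lemma represents_exists B : measurable B -> exists P, represents P B.
Proof.
move=> mB.
apply: (@dynkin_induction _ R (@ocitv R) (fun B => exists P, represents P B)) => //.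
- exact: ocitvI.
- by exists id; split=> //; apply: isproj_id.
- by move=> _ [[a b] _ <-]; apply: mu_oc.
- move=> A mA [P [hP PA]]; exists (fun x => x - P x); split; first exact: isproj_compl.
  move=> x; have fin : (mu x setT < +oo)%E by rewrite muT ltry.
  by rewrite rdotBl EFinB -PA -muT -setTD measureD// setTI.
- move=> F mF tF /choice[P hP].
  by have [Q hQ _] := represents_bigcup mF tF hP; exists Q.
Qed.

Lemma spectral_family : exists E : set R -> H -> H,
  [/\ forall B, measurable B -> represents (E B) B,
      E setT = id,
      forall A B, measurable A -> measurable B -> E (A `&` B) = E A \o E B
    & forall F : (set R)^nat, (forall k, measurable (F k)) ->
        trivIset setT F -> forall x,
        (fun n => \sum_(0 <= k < n) E (F k) x) @ \oo -->
          E (\bigcup_k F k) x].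
Proof.
have /choice[E hE] : forall B : set R, exists P, measurable B -> represents P B.
  move=> B; have [/represents_exists[P hP]|nB] := pselect (measurable B).
    by exists P.
  by exists id.
exists E; split=> //.
- by apply: (@represents_unique _ _ setT); [exact: hE|split=> //; exact: isproj_id].
(* Multiplicativity: split both [A] and [B] along their intersection; in the product all mixed terms
   come from disjoint sets and vanish. *)
- have addE A B : measurable A -> measurable B -> E A =
      fun x => E (A `&` B) x + E (A `\` B) x.
    move=> mA mB; have mI : measurable (A `&` B) by apply: measurableI.
    have mD : measurable (A `\` B) by apply: measurableD.
    have [[l0 s0 _] h0] := hE A mA.
    have [[l1 s1 _] h1] := hE _ mI; have [[l2 s2 _] h2] := hE _ mD.
    apply: rsym_form_eq => //.
    + by move=> a x y; rewrite l1 l2 addrACA scalerDr.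
    + by move=> x y; rewrite !rdotE s1 s2.
    + move=> x; apply: EFin_inj; rewrite -h0 rdotDl EFinD -h1 -h2.
      by rewrite addeC -measureDI.
  move=> A B mA mB; have mI : measurable (A `&` B) by apply: measurableI.
  have mD : measurable (A `\` B) by apply: measurableD.
  have mD' : measurable (B `\` A) by apply: measurableD.
  apply/funext => x /=; rewrite (addE A B mA mB) (addE B A mB mA) (setIC B).
  have [[l1 s1 PP] _] := hE _ mI; have [[l2 _ _] _] := hE _ mD.
  rewrite (linopD l1) (linopD l2) PP.
  have o C D : measurable C -> measurable D -> C `&` D = set0 -> E C (E D x) = 0.
    by move=> mC' mD1 CD; apply: (represents_disjoint mC' mD1 (hE _ mC') (hE _ mD1)).
  by rewrite !o ?addr0//; apply/seteqP; split=> // t [/= [? ?] [? ?]].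
- move=> F mF tF x.
  have [Q hQ hx] := represents_bigcup mF tF (fun k => hE _ (mF k)).
  by rewrite (represents_unique (hE _ (bigcupT_measurable F mF)) hQ).
Qed.

End spectral_family.

(** * The spectral theorem *)

(* [eq_measure_integral] for raw set functions: the values taken on
   non-measurable sets do not matter. *)
Lemma eq_integral_measurable d (T : measurableType d) (R : realType)
    (m1 m2 : set T -> \bar R) (D : set T) (f : T -> \bar R) :
  (forall A, measurable A -> m1 A = m2 A) ->
  (\int[m1]_(x in D) f x = \int[m2]_(x in D) f x)%E.
Proof.
move=> m12; have e : (fun h : {nnsfun T >-> R} => sintegral m1 h) =
    (fun h : {nnsfun T >-> R} => sintegral m2 h).
  by apply/funext => h; apply: eq_fsbigr => r _; rewrite m12.
by rewrite /integral /= e.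
Qed.

(** The Lebesgue-Stieltjes measure of [F], repackaged over [R] itself; on half-open intervals the
    extension agrees with the length it starts from. *)
Lemma stieltjes_measure (R : realType) (F : R -> R) :
  {homo F : a b / a <= b} -> right_continuous F ->
  exists mu : {measure set R -> \bar R},
    forall a b, a <= b -> mu `]a, b]%classic = (F b - F a)%:E.
Proof.
move=> ndF rcF.
pose f : cumulative R R := HB.pack F (isCumulative.Build R _ R F ndF rcF).
pose m : set R -> \bar R := lebesgue_stieltjes_measure f.
pose mu : {measure set R -> \bar R} := HB.pack m
  (isMeasure.Build _ R R m (measure0 (lebesgue_stieltjes_measure f))
    (measure_ge0 (lebesgue_stieltjes_measure f))
    (@measure_semi_sigma_additive _ _ _ (lebesgue_stieltjes_measure f))).
exists mu => a b ab.
rewrite /= /m /lebesgue_stieltjes_measure /measure_extension.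
rewrite measurable_mu_extE/=; last exact: is_ocitv.
by rewrite wlength_itv_bnd.
Qed.

(** * From half-line projections to a spectral measure *)

Section resolution_of_identity.
Context (R : realType) (H : hilbertType R) (S : H -> H).
Hypotheses (linS : linear S) (symS : rsym S).
Hypotheses (S_ge0 : forall x, 0 <= rdot (S x) x).
Hypotheses (S_le1 : forall x, rdot (S x) x <= rdot x x).
(* [Q t] is the spectral projection of [S] for [`]t, +oo[]. *)
Context (Q : R -> H -> H).
Hypothesis projQ : forall t, isproj (Q t).
Hypothesis comQ : forall t (K : H -> H), bounded_operator K ->
  (forall x, K (S x) = S (K x)) -> forall x, K (Q t x) = Q t (K x).
Hypothesis lowQ : forall t x, t * rdot (Q t x) (Q t x) <= rdot (S (Q t x)) (Q t x).
Hypothesis upQ : forall t x,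
  rdot (S (x - Q t x)) (x - Q t x) <= t * rdot (x - Q t x) (x - Q t x).
Hypothesis densQ : forall t x (e : R), 0 < e ->
  exists v, nrm (Q t x - (S v - t%:C *: v)) < e.
Implicit Types (x y z : H) (a b t u : R).

Let linQ t : linear (Q t).
Proof. by have [] := projQ t. Qed.

Let symQ t : rsym (Q t).
Proof. by have [] := projQ t. Qed.

Let QQid t x : Q t (Q t x) = Q t x.
Proof. by have [] := projQ t. Qed.

Let QS t x : Q t (S x) = S (Q t x).
Proof.
by apply/esym/comQ => //; apply: contraction_bounded.
Qed.

Let QQ t u x : Q t (Q u x) = Q u (Q t x).
Proof.
by apply: comQ => [|y]; [have [] := isproj_orthogonal (projQ t)|exact: QS].
Qed.

Let low t z : Q t z = z -> t * rdot z z <= rdot (S z) z.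
Proof. by move=> <-. Qed.

Let up t z : Q t z = 0 -> rdot (S z) z <= t * rdot z z.
Proof. by move=> Qz; have := upQ t z; rewrite Qz subr0. Qed.

(** For [t < u] the difference z lies in the range of [Q u] and the kernel of [Q t], so u |z|^2 <=
    <S z, z> <= t |z|^2 and z = 0. *)
Let Q_decr t u x : t <= u -> Q t (Q u x) = Q u x.
Proof.
rewrite le_eqVlt => /predU1P[<-//|tu].
pose z := Q u x - Q t (Q u x).
have Quz : Q u z = z by rewrite (linopB (linQ u)) QQid (QQ u t) QQid.
have Qtz : Q t z = 0 by rewrite (linopB (linQ t)) QQid subrr.
have := low Quz; have := up Qtz; have := rdot_ge0 z => z0 h1 h2.
by apply/esym/subr0_eq/rdot_eq0/eqP; rewrite -/z eq_le z0 andbT; nra.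
Qed.

Let Q_neg t x : t < 0 -> Q t x = x.
Proof.
move=> t0; pose z := x - Q t x.
have Qtz : Q t z = 0 by rewrite (linopB (linQ t)) QQid subrr.
have := up Qtz; have := S_ge0 z; have := rdot_ge0 z => z0 h1 h2.
by apply/esym/subr0_eq/rdot_eq0/eqP; rewrite -/z eq_le z0 andbT; nra.
Qed.

Let Q_gt1 t x : 1 < t -> Q t x = 0.
Proof.
move=> t1; pose z := Q t x.
have := low (QQid t x); have := S_le1 z; have := rdot_ge0 z; rewrite -/z => z0 h1 h2.
by apply/rdot_eq0/eqP; rewrite eq_le z0 andbT; nra.
Qed.

(** The distribution function of the scalar measure of [x]: the complement of [Q t] belongs to
    []-oo, t]]. *)
Let F x t := rdot (x - Q t x) x.

Let FB x a b : F x b - F x a = rdot (Q a x - Q b x) x.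
Proof. by rewrite /F !rdotE; ring. Qed.

Let projB a b : a <= b -> isproj (fun x => Q a x - Q b x).
Proof. by move=> ab; apply: isproj_sub => // x; apply: Q_decr. Qed.

Lemma resolution_nondecreasing x : {homo F x : a b / a <= b}.
Proof.
move=> a b ab; rewrite -subr_ge0 FB (rdot_proj x (projB ab)); exact: rdot_ge0.
Qed.

(** On the range of Q a - Q b one has 0 <= S - a <= b - a, hence (S - a)^2 <= (b - a)(S - a) <= (b -
    a)^2. *)
Let range_bounds a b z : a < b -> Q a z = z -> Q b z = 0 ->
  nrm (S z - a%:C *: z) <= (b - a) * nrm z.
Proof.
move=> ab Qaz Qbz; pose A y := S y - a%:C *: y.
have linA : linear A.
  by move=> c x y; rewrite /A linS scalerDr scalerBr !scalerA (mulrC c) opprD addrACA.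
have symA : rsym A by move=> x y; rewrite /A !rdotE symS.
have QaA : Q a (A z) = A z by rewrite (linopB (linQ a)) (linopZ (linQ a)) QS Qaz.
have QbA : Q b (A z) = 0.
  by rewrite (linopB (linQ b)) (linopZ (linQ b)) QS Qbz (linop0 linS) scaler0 subrr.
have ba : 0 < b - a by rewrite subr_gt0.
have Age0 y : Q a y = y -> 0 <= rdot (A y) y.
  by move=> /low; rewrite /A rdotBl rdotZl subr_ge0.
have Ale y : Q b y = 0 -> rdot (A y) y <= (b - a) * rdot y y.
  by move=> /up; rewrite /A rdotBl rdotZl mulrBl lerD2r.
have h : rdot (A z) (A z) <= (b - a) * rdot (A z) z.
  apply: rdot_sqr_le => //; last exact: Ale.
  by apply: Age0; rewrite (linopB (linQ a)) (linopZ (linQ a)) Qaz QaA.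
apply: nrm_le; first by rewrite mulr_ge0// ?nrm_ge0// ltW.
apply: le_trans h _; rewrite exprMn sqr_nrm expr2 -mulrA ler_pM2l//.
exact: Ale.
Qed.

Let nrm_proj (P : H -> H) x : isproj P -> nrm (P x) <= nrm x.
Proof. by move=> hP; apply: nrm_rdot_le; rewrite -rdot_proj// rdot_proj_le. Qed.

(** Put D = Q a - Q u and approximate [Q a x] by (S - a) v. Then D x is D of a small vector plus (S
    - a) D v, and [range_bounds] makes the latter of order u - a. *)
Lemma resolution_right_continuous x : right_continuous (F x).
Proof.
move=> a; apply/cvgrPdist_lt => e e0.
(* Two errors below [r] in norm give a squared norm below [(r + r) ^+ 2 = e]. *)
pose r := Num.sqrt e / 2.
have r0 : 0 < r by rewrite divr_gt0// sqrtr_gt0.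
have [v hv] := densQ a x r0.
have v1 : 0 < nrm v + 1 by have := nrm_ge0 v; lra.
exists (r / (nrm v + 1)) => /=; first exact: divr_gt0.
move=> u /=; rewrite ltr_pdivlMr// distrC => h au.
rewrite gtr0_norm ?subr_gt0// in h.
rewrite distrC ger0_norm ?subr_ge0 ?resolution_nondecreasing ?ltW// FB.
have pD := projB (ltW au); rewrite (rdot_proj x pD) -sqr_nrm.
have -> : e = (r + r) ^+ 2.
  by rewrite /r -splitr sqr_sqrtr// ltW.
rewrite ltr_pXn2r ?nnegrE ?nrm_ge0 ?addr_ge0 ?ltW//.
have [lD _ _] := pD; set D := fun x => _ in pD lD.
have DE : D x = D (Q a x - (S v - a%:C *: v)) + (S (D v) - a%:C *: D v).
  have -> : S (D v) - a%:C *: D v = D (S v - a%:C *: v).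
    by rewrite (linopB lD) (linopZ lD) /D !QS (linopB linS).
  rewrite -(linopD lD) subrK /D QQid; congr (_ - _).
  by rewrite QQ Q_decr// ltW.
rewrite -[X in nrm X]/(D x) DE.
have h1 := nrm_proj (Q a x - (S v - a%:C *: v)) pD.
have h2 : nrm (S (D v) - a%:C *: D v) <= (u - a) * nrm (D v).
  apply: range_bounds => //; rewrite /D.
    by rewrite (linopB (linQ a)) QQid Q_decr// ltW.
  by rewrite (linopB (linQ u)) QQid QQ Q_decr ?subrr// ltW.
have h3 := nrm_proj v pD.
have h4 := nrmD (D (Q a x - (S v - a%:C *: v))) (S (D v) - a%:C *: D v).
apply: (le_lt_trans h4); move: h h1 h2 h3 hv.
have := nrm_ge0 (D v); have := nrm_ge0 v.
move: (nrm _) (nrm _) (nrm _) (nrm _) (nrm _) => p q s w z.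
have : 0 < u - a by rewrite subr_gt0.
nra.
Qed.

Context (mu : H -> {measure set R -> \bar R}).
Hypothesis muF : forall x a b, a <= b -> mu x `]a, b]%classic = (F x b - F x a)%:E.

Let mu_total x : mu x setT = (rdot x x)%:E.
Proof.
(* Starting at 2 puts the right end strictly above 1, as [Q_gt1] demands; every [I n] then carries
   the full mass. *)
pose I n : set R := `](- n.+2%:R), n.+2%:R]%classic.
have Icov : \bigcup_n I n = setT.
  apply/seteqP; split=> // t _; exists (Num.bound `|t|) => //.
  have := archi_boundP (normr_ge0 t); move: (Num.bound _) => n.
  rewrite ltr_norml => /andP[].
  by rewrite /I /= in_itv /= -addn2 natrD; lra.
have h1 : mu x \o I @ \oo --> mu x (\bigcup_n I n).
  apply: nondecreasing_cvg_mu; rewrite /I//; first exact: bigcup_measurable.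
  move=> m n mn; apply/subsetPset/subset_itv; rewrite leBSide/= ?lerN2 ler_nat.
    by rewrite !ltnS.
  by rewrite !ltnS.
rewrite Icov in h1.
have h2 : mu x \o I = cst (rdot x x)%:E.
  apply/funext => n /=; rewrite /I muF; last by rewrite (@le_trans _ _ 0)// oppr_le0.
  by rewrite FB Q_neg ?oppr_lt0// Q_gt1 ?subr0// ltr1n.
rewrite h2 in h1.
by apply: (cvg_unique _ h1) (cvg_cst _); exact: ereal_hausdorff.
Qed.

Let mu_ivl a b : exists P, represents mu P `]a, b]%classic.
Proof.
have [ab|ba] := leP a b.
  exists (fun x => Q a x - Q b x); split; first exact: projB.
  by move=> x; rewrite muF// FB.
exists (fun=> 0); split; first exact: isproj0.
by move=> x; rewrite set_itv_ge ?measure0 ?rdot0l// bnd_simp -leNgt ltW.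
Qed.

Let fin_mu x B : measurable B -> (mu x B < +oo)%E.
Proof.
move=> mB; apply: le_lt_trans (_ : mu x setT < +oo)%E; last by rewrite mu_total ltry.
by rewrite le_measure ?inE.
Qed.

Let integrable_ivl x a b : (mu x).-integrable `]a, b]%classic (EFin : R -> \bar R).
Proof.
apply: (@measurable_bounded_integrable _ _ _ _ (fun t : R => t)) => //.
  exact: fin_mu.
exists (`|a| + `|b|); split; first by rewrite num_real.
move=> M hM t /=; rewrite in_itv /= => /andP[at_ tb].
apply: le_trans (ltW hM); rewrite ler_norml; apply/andP; split.
  have := ler_norm (- a); rewrite normrN; have := normr_ge0 b; lra.
have := ler_norm b; have := normr_ge0 a; lra.
Qed.

Let mu_out x a b : a < 0 -> 1 < b -> mu x (~` `]a, b]%classic) = 0%E.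
Proof.
move=> a0 b1.
have -> : mu x (~` `]a, b]%classic) = (mu x setT - mu x `]a, b]%classic)%E.
  by rewrite -setTD measureD// ?setTI//; exact: fin_mu.
rewrite mu_total muF ?FB; last by lra.
by rewrite Q_neg// Q_gt1// subr0 subee.
Qed.

Let integrable_id x : (mu x).-integrable setT (EFin : R -> \bar R).
Proof.
have mC : measurable (~` `](-1 : R), 2%:R]%classic) by exact: measurableC.
have N0 : mu x (~` `](-1 : R), 2%:R]%classic) = 0%E.
  by apply: mu_out; [rewrite ltrN10|rewrite ltr1n].
apply/(negligible_integrable mC measurableT _ N0); first exact/measurable_EFinP.
by rewrite setTD setCK; apply: integrable_ivl.
Qed.

Let G x b : R := \int[mu x]_(t in `](-1 : R), b]%classic) t.

Let GB x a b : -1 <= a -> a <= b ->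
  G x b - G x a = \int[mu x]_(t in `]a, b]%classic) t.
Proof.
move=> a1 ab; rewrite /G (@itv_bndbnd_setU _ _ _ (BRight a)) ?bnd_simp//.
rewrite Rintegral_setU//.
- by rewrite addrAC subrr add0r.
- rewrite -itv_bndbnd_setU ?bnd_simp//; exact: integrable_ivl.
- apply/disj_setPS => t [] /=; rewrite !in_itv /= => /andP[_ ta] /andP[at_ _].
  by move: (le_lt_trans ta at_); rewrite ltxx.
Qed.

Let ivl_bounds x a b : a <= b ->
  a * (F x b - F x a) <= \int[mu x]_(t in `]a, b]%classic) t <= b * (F x b - F x a).
Proof.
move=> ab; have e c : c * (F x b - F x a) = \int[mu x]_(t in `]a, b]%classic) c.
  by rewrite Rintegral_cst// muF.
have ic c : (mu x).-integrable `]a, b]%classic (EFin \o cst c).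
  by apply: measurable_bounded_integrable => //; [exact: fin_mu|exact: bounded_cst].
rewrite !e; apply/andP; split; apply: le_Rintegral => //;
  try exact: integrable_ivl; try exact: ic.
  by move=> t /=; rewrite in_itv/= => /andP[/ltW].
by move=> t /=; rewrite in_itv/= => /andP[].
Qed.

Let s x b : R := rdot (S (x - Q b x)) x.

Let s_bounds x a b : a <= b ->
  a * (F x b - F x a) <= s x b - s x a <= b * (F x b - F x a).
Proof.
move=> ab; have := projB ab; pose D y := Q a y - Q b y; rewrite -/D => -[lD sD DD].
have DS y : D (S y) = S (D y) by rewrite /D !QS (linopB linS).
have sE : s x b - s x a = rdot (S (D x)) (D x).
  rewrite /s -rdotBl -(linopB linS).
  have -> : x - Q b x - (x - Q a x) = D x.
    by rewrite opprB addrC addrA subrK.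
  by rewrite -sD DS DD.
have FE : F x b - F x a = rdot (D x) (D x) by rewrite FB -sD DD.
rewrite sE FE; apply/andP; split.
  by apply: low; rewrite /D (linopB (linQ a)) QQid Q_decr.
by apply: up; rewrite /D (linopB (linQ b)) QQid QQ Q_decr ?subrr.
Qed.

(** A Riemann-sum argument: on []a, b]] the increments of both [G x] and [s x] lie between [a] and
    [b] times that of [F x], so on a mesh [d] they differ by at most [d] times it. *)
Let integral_id x : \int[mu x]_(t in setT) t = rdot (S x) x.
Proof.
have -> : \int[mu x]_(t in setT) t = G x 2%:R.
  have mC : measurable (~` `](-1 : R), 2%:R]%classic) by exact: measurableC.
  have N0 : mu x (~` `](-1 : R), 2%:R]%classic) = 0%E.
    by apply: mu_out; [rewrite ltrN10|rewrite ltr1n].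
  rewrite /Rintegral (negligible_integral mC measurableT (integrable_id x) N0).
  by rewrite setTD setCK.
have -> : rdot (S x) x = s x 2%:R by rewrite /s Q_gt1 ?subr0// ltr1n.
(* [N.+1] steps of this size lead from -1, where both functions vanish, to 2, beyond the
   spectrum. *)
pose d N : R := 3%:R / N.+1%:R.
have d0 N : 0 < d N by rewrite divr_gt0// ltr0n.
have main N k :
    `|G x (-1 + k%:R * d N) - s x (-1 + k%:R * d N)| <= d N * F x (-1 + k%:R * d N).
  elim: k => [|k IH].
    rewrite mul0r addr0 /G /s /F set_itvxx Rintegral_set0 !Q_neg ?ltrN10//.
    by rewrite subrr (linop0 linS) rdot0l subrr normr0 mulr0.
  move: IH; set b := -1 + k%:R * d N.
  have -> : -1 + k.+1%:R * d N = b + d N by rewrite -addn1 natrD /b; ring.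
  set b' := b + d N => IH.
  have bb : b <= b' by rewrite /b' lerDl ltW.
  have b1 : -1 <= b by rewrite /b lerDl mulr_ge0 ?ler0n// ltW.
  have := ivl_bounds x bb; rewrite -(GB x b1 bb).
  have := s_bounds x bb.
  have -> : b' * (F x b' - F x b) = b * (F x b' - F x b) + d N * F x b' - d N * F x b.
    by rewrite /b'; ring.
  move: IH; rewrite !ler_norml => /andP[h1 h2] /andP[h3 h4] /andP[h5 h6].
  apply/andP; split; lra.
apply/eqP; rewrite -subr_eq0 -normr_le0 leNgt; apply/negP => e0.
pose e := `|G x 2%:R - s x 2%:R|; rewrite -/e in e0.
pose N := Num.bound (3%:R * rdot x x / e).
have := main N N.+1.
have -> : -1 + N.+1%:R * d N = 2%:R.
  by rewrite /d mulrC divfK ?pnatr_eq0//; ring.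
rewrite -/e /F Q_gt1 ?ltr1n// subr0 /d mulrAC ler_pdivlMr ?ltr0n//.
apply/negP; rewrite -ltNge.
have := @archi_boundP _ (3%:R * rdot x x / e); rewrite -/N ltr_pdivrMr// => h.
have {}h := h (divr_ge0 (mulr_ge0 (ler0n _ _) (rdot_ge0 x)) (ltW e0)).
by apply: lt_le_trans h _; rewrite mulrC ler_pM2l// ler_nat.
Qed.

Lemma resolution_spectral_measure : exists E, is_spectral_measure S E.
Proof.
have [E [hE ET EI EU]] := spectral_family mu_total mu_ivl.
have muE x B : measurable B -> mu x B = scalar_measure E x B.
  by move=> mB; have [_ ->] := hE B mB.
exists E; split=> //.
  by move=> B mB; have [pB _] := hE B mB; apply: isproj_orthogonal.
move=> x; split.
  have /integrableP[m1 m2] := integrable_id x; apply/integrableP; split=> //.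
  by rewrite -(eq_integral_measurable _ _ (muE x)).
rewrite -(eq_integral_measurable _ _ (muE x)).
rewrite [fine _]integral_id.
have := rsym_dotp linS symS x x; rewrite (dotpC x (S x)) /rdot.
by case: (dotp (S x) x) => a b /= [] h; congr (_ +i* _); lra.
Qed.

End resolution_of_identity.

Lemma spectral_theorem (R : realType) (H : hilbertType R) (S : H -> H) :
  linear S -> rsym S -> (forall x, 0 <= rdot (S x) x) ->
  (forall x, rdot (S x) x <= rdot x x) -> exists E, is_spectral_measure S E.
Proof.
move=> linS symS S_ge0 S_le1.
have /choice[Q hQ] := spectral_cut linS symS S_ge0 S_le1.
have projQ t : isproj (Q t) by have [[[? _] ? ?] _ _ _] := hQ t.
have comQ t : forall K : H -> H, bounded_operator K ->
    (forall x, K (S x) = S (K x)) -> forall x, K (Q t x) = Q t (K x).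
  by have [] := hQ t.
have lowQ t : forall x, t * rdot (Q t x) (Q t x) <= rdot (S (Q t x)) (Q t x).
  by have [_ _ [] //] := hQ t.
have upQ t : forall x,
    rdot (S (x - Q t x)) (x - Q t x) <= t * rdot (x - Q t x) (x - Q t x).
  by have [_ _ [] //] := hQ t.
have densQ t : forall x (e : R), 0 < e ->
    exists v, nrm (Q t x - (S v - t%:C *: v)) < e.
  by have [] := hQ t.
pose F x t := rdot (x - Q t x) x.
have /choice[mu muF] : forall x, exists m : {measure set R -> \bar R},
    forall a b, a <= b -> m `]a, b]%classic = (F x b - F x a)%:E.
  move=> x; apply: stieltjes_measure.
    exact: (resolution_nondecreasing linS symS S_ge0 S_le1 projQ comQ lowQ upQ).
  exact: (resolution_right_continuous linS symS S_ge0 S_le1 projQ comQ lowQ upQ densQ).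
exact: (resolution_spectral_measure linS symS S_ge0 S_le1 projQ comQ lowQ upQ muF).
Qed.

(** * Bounds on the ranges of spectral projections *)

Lemma integral_le0_null (R : realType) (mu : {measure set R -> \bar R}) (B : set R)
    (f : R -> R) : measurable B -> mu.-integrable B (EFin \o f) ->
  (forall t, B t -> 0 < f t) -> \int[mu]_(t in B) f t <= 0 -> mu B = 0%E.
Proof.
move=> mB intf f0 If.
have If0 : (\int[mu]_(t in B) (f t)%:E = 0)%E.
  apply/eqP; rewrite eq_le integral_ge0 ?andbT; last first.
    by move=> t Bt; rewrite lee_fin ltW// f0.
  rewrite -[leLHS]fineK; last exact: integrable_fin_num.
  by rewrite lee_fin.
have mf : measurable_fun B (EFin \o f) by exact: (measurable_int mu).
have : (\int[mu]_(t in B) `|(EFin \o f) t| = 0)%E.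
  rewrite -[RHS]If0; apply: eq_integral => t /set_mem Bt /=.
  by rewrite ger0_norm// ltW// f0.
move=> /(ae_eq_integral_abs _ mB mf)[A [mA A0 BA]].
apply/eqP; rewrite eq_le measure_ge0 andbT -A0 le_measure ?inE// => t Bt.
by apply: BA => /= /(_ Bt) [e]; move: (f0 t Bt); rewrite e ltxx.
Qed.

(** * Consequences of the defining properties of a spectral measure *)

Section spectral_measure_facts.
Context (R : realType) (H : hilbertType R) (S : H -> H) (E : set R -> H -> H).
Hypotheses (linS : linear S) (symS : rsym S) (SE : is_spectral_measure S E).
Implicit Types (x y : H) (B : set R).

Lemma spectral_isproj B : measurable B -> isproj (E B).
Proof. by move=> mB; apply: orthogonal_isproj; have [+ _ _ _ _] := SE; apply. Qed.

Lemma spectralT x : E setT x = x.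
Proof. by have [_ -> _ _ _] := SE. Qed.

Lemma spectralI A B x : measurable A -> measurable B -> E (A `&` B) x = E A (E B x).
Proof. by move=> mA mB; have [_ _ h _ _] := SE; rewrite h. Qed.

(** Countable additivity for the constant sequence [set0] makes the multiples of [E set0 x]
    converge, so their increments tend to 0. *)
Lemma spectral0 x : E set0 x = 0.
Proof.
have [_ _ _ + _] := SE; move=> /(_ (fun=> set0)) /(_ (fun _ => measurable0)).
move=> /(_ (@trivIset_set0 _ _ _)) /(_ x) h.
pose u n := \sum_(0 <= k < n) E set0 x.
have h' := h; rewrite -cvg_shiftS in h'.
have {}h := cvgB h' h; rewrite subrr in h.
have {}h : (fun=> E set0 x) @ \oo --> (0 : H).
  apply: (@cvg_limit_ext _ _ (fun n => u n.+1 - u n)); first exact: h.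
  by move=> n; rewrite /u big_nat_recr//= addrAC subrr add0r.
exact: (cvgH_unique (@cvg_cst _ _ _ _ _) h).
Qed.

Lemma spectral_scalar_measure x : exists m : {measure set R -> \bar R},
  forall B, measurable B -> m B = (rdot (E B x) x)%:E.
Proof.
(* Nothing controls [E] on non-measurable sets; the default 0 keeps [m] nonnegative everywhere. *)
pose m B := if `[< measurable B >] then scalar_measure E x B else 0%E.
have mE B : measurable B -> m B = (rdot (E B x) x)%:E by move=> mB; rewrite /m asboolT.
have m0 : m set0 = 0%E by rewrite mE// spectral0 rdot0l.
have m_ge0 B : (0 <= m B)%E.
  have [mB|mB] := pselect (measurable B); last by rewrite /m asboolF.
  by rewrite mE// lee_fin rdot_proj ?rdot_ge0//; apply: spectral_isproj.
have m_sigma : semi_sigma_additive m.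
  move=> F mF tF mUF; rewrite mE//.
  have [_ _ _ /(_ F mF tF x) h _] := SE.
  have {}h : (fun n => (rdot (\sum_(0 <= k < n) E (F k) x) x)%:E) @ \oo -->
      (rdot (E (\bigcup_k F k) x) x)%:E.
    apply: cvg_EFin; first exact: nearW.
    by apply: cvg_rdot => //; apply: cvg_cst.
  apply: cvg_trans h; apply: near_eq_cvg; apply: nearW => n /=.
  elim: n => [|n IH]; first by rewrite !big_nil rdot0l.
  by rewrite !big_nat_recr//= rdotDl EFinD IH mE.
pose mu : {measure set R -> \bar R} :=
  HB.pack m (isMeasure.Build _ R R m m0 m_ge0 m_sigma).
by exists mu => B mB; rewrite -mE.
Qed.

Lemma spectralC B x : measurable B -> E (~` B) x = x - E B x.
Proof.
move=> mB; have mC : measurable (~` B) by exact: measurableC.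
have pB := spectral_isproj mB; have [l1 s1 _] := spectral_isproj mC.
have [l2 s2 _] := isproj_compl pB.
suff -> : E (~` B) = (fun x => x - E B x) by [].
apply: rsym_form_eq => // {}x.
have [m hm] := spectral_scalar_measure x.
have mT : m setT = (rdot x x)%:E by rewrite hm// spectralT.
have fin : (m setT < +oo)%E by rewrite mT ltry.
have e : m (~` B) = (m setT - m B)%E by rewrite -setTD measureD// setTI.
by apply: EFin_inj; rewrite -hm// e mT hm// rdotBl EFinB.
Qed.

Lemma spectral_integral x (m : {measure set R -> \bar R}) :
  (forall B, measurable B -> m B = (rdot (E B x) x)%:E) ->
  m.-integrable setT (EFin : R -> \bar R) /\ \int[m]_(t in setT) t = rdot (S x) x.
Proof.
move=> hm; have [_ _ _ _ /(_ x)[/integrableP[m1 m2] eS]] := SE.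
have e B : measurable B -> m B = scalar_measure E x B by exact: hm.
split; last by rewrite /Rintegral (eq_integral_measurable _ _ e) /rdot eS.
by apply/integrableP; split=> //; rewrite (eq_integral_measurable _ _ e).
Qed.

(** For p in the range and q in the kernel of [E B], the scalar measure of p + q is the sum of those
    of p and q. Hence the form of [S] has no cross term, and [S] preserves both subspaces. *)
Lemma spectral_commute B x : measurable B -> E B (S x) = S (E B x).
Proof.
move=> mB; pose P := E B; have [lP sP PP] : isproj P := spectral_isproj mB.
rewrite -/P.
have PC C y : measurable C -> P (E C y) = E C (P y).
  by move=> mC; rewrite /P -!spectralI// setIC.
have orth p q : P p = p -> P q = 0 -> rdot (S p) q = 0.
  move=> Pp Pq.
  have [m hm] := spectral_scalar_measure (p + q).
  have [m1 hm1] := spectral_scalar_measure p.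
  have [m2 hm2] := spectral_scalar_measure q.
  have [_ e] := spectral_integral hm.
  have [i1 e1] := spectral_integral hm1.
  have [i2 e2] := spectral_integral hm2.
  have m12 C : measurable C -> m C = measure_add m1 m2 C.
    move=> mC; have [lC sC _] := spectral_isproj mC.
    rewrite measure_addE hm// hm1// hm2// -EFinD; congr EFin.
    have Epq : rdot (E C p) q = 0 by rewrite -Pp -PC// sP Pq rdot0r.
    by rewrite (linopD lC) !rdotE (sC q) [rdot q _]rdotC Epq; ring.
  move: e; rewrite /Rintegral (eq_integral_measurable _ _ m12).
  rewrite integral_measure_add// fineD; [|exact: integrable_fin_num..].
  rewrite -[X in X + _]/(\int[m1]_(t in setT) t) -[X in _ + X]/(\int[m2]_(t in setT) t).
  rewrite e1 e2 (linopD linS) !rdotE (symS q p) (rdotC q (S p)); lra.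
have PSP y : P (S (P y)) = S (P y).
  apply: rdot_eq => w; rewrite sP; apply/eqP; rewrite -subr_eq0 -rdotBr.
  rewrite -oppr_eq0 -rdotNr opprB orth//.
  by rewrite (linopB lP) PP subrr.
by apply: rdot_eq => w; rewrite sP symS -PSP -sP -symS -sP PSP.
Qed.

(* Strictness: a positive function with zero integral lives on a null set, and
   [x = E B x] has scalar measure [rdot x x] on [B]. *)
Lemma spectral_affine B (a b : R) x : measurable B -> E B x = x ->
  ((forall t, B t -> 0 <= a * t + b) -> 0 <= a * rdot (S x) x + b * rdot x x) /\
  ((forall t, B t -> 0 < a * t + b) -> x <> 0 -> 0 < a * rdot (S x) x + b * rdot x x).
Proof.
move=> mB EBx; have mC : measurable (~` B) by exact: measurableC.
have [m hm] := spectral_scalar_measure x.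
have [im em] := spectral_integral hm.
have mCB0 : m (~` B) = 0%E by rewrite hm// spectralC// EBx subrr rdot0l.
have iB : m.-integrable B (EFin \o (fun t : R => t)).
  by apply: integrableS im.
have iaB : m.-integrable B (EFin \o (fun t : R => a * t)).
  exact: (integrableZl mB a iB).
have mBE : m B = (rdot x x)%:E by rewrite hm// EBx.
have ibB : m.-integrable B (EFin \o cst b).
  apply: measurable_bounded_integrable => //; last exact: bounded_cst.
  by rewrite mBE ltry.
have e : \int[m]_(t in B) (a * t + b) = a * rdot (S x) x + b * rdot x x.
  rewrite RintegralD// RintegralZl// Rintegral_cst// mBE -em; congr (a * _ + _).
  by rewrite [RHS]/Rintegral (negligible_integral mC measurableT im mCB0) setTD setCK.
split=> [h|h x0]; rewrite -e; first exact: Rintegral_ge0.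
rewrite ltNge; apply/negP => /(@integral_le0_null _ _ _ (fun t => a * t + b) mB).
move=> mB0; apply: x0; apply: rdot_eq0; apply: EFin_inj; rewrite -mBE mB0//.
exact: (integrableD mB iaB ibB).
Qed.

End spectral_measure_facts.

(** * Rank comparison and finiteness *)

Section rank_comparison.
Context (R : realType) (H : hilbertType R).

(** [Q] is injective on the range of [P] and so maps independent families there to independent
    families. *)
Lemma le_oprank (P Q : H -> H) : isproj P -> isproj Q ->
  (forall x, P x = x -> Q x = 0 -> x = 0) -> (oprank P <= oprank Q)%E.
Proof.
move=> [lP _ PP] [lQ _ _] PQ; apply: le_ereal_sup => _ [n [v [vfree vP]] <-].
exists n => //; exists (fun i => Q (v i)); split=> [c|i]; last by exists (v i).
have {}vP i : P (v i) = v i by have [w _ <-] := vP i.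
move=> cQ; apply: vfree; apply: PQ.
  by rewrite (linop_sum lP); apply: eq_bigr => i _; rewrite (linopZ lP) vP.
by rewrite (linop_sum lQ) -[RHS]cQ; apply: eq_bigr => i _; rewrite (linopZ lQ).
Qed.

Lemma dotp_suml n (w : 'I_n -> H) (y : H) :
  dotp (\sum_i w i) y = \sum_i dotp (w i) y.
Proof.
elim: n w => [|n IH] w; first by rewrite !big_ord0 dotp0l.
by rewrite !big_ord_recl dotpDl IH.
Qed.

Lemma oprank_lty (P T : H -> H) (r : R) : isproj P -> linear T ->
  compact_operator T -> 0 < r ->
  (forall x, P x = x -> r * rdot x x <= rdot (T x) x) -> (oprank P < +oo)%E.
Proof.
move=> [lP _ PP] lT cT r0 hT.
pose f (y : H) : set H := [set x | `|y - x| < r%:C].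
have fo y : open (f y).
  have -> : f y = ball y r%:C by rewrite -ball_normE.
  by apply: ball_open; rewrite ltcR.
move: cT; rewrite /compact_operator compact_cover.
move=> /(_ H setT f (fun y _ => fo y))[z _|D _ hD].
  by exists z => //; rewrite /f /= subrr normr0 ltcR.
pose N := size (enum_fset D).
have net x : nrm x <= 1 -> exists j : 'I_N, nrm (T x - (enum_fset D)`_j) < r.
  move=> x1; have [|y yD /= yx] := hD (T x).
    by apply: subset_closure; exists x => //=; rewrite normE lecR.
  move: yx; rewrite /f /= normE ltcR nrmBC => yx.
  have yD' : y \in enum_fset D by [].
  have jN : (index y (enum_fset D) < N)%N by rewrite index_mem.
  by exists (Ordinal jN); rewrite /= nth_index.
suff : (oprank P <= N%:R%:E)%E by move=> /le_lt_trans; apply; rewrite ltry.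
apply: ge_ereal_sup => _ [n [v [vfree vP]] <-].
have {}vP i : P (v i) = v i by have [w _ <-] := vP i.
rewrite lee_fin ler_nat leqNgt; apply/negP => Nn.
(* With more rows than columns the left kernel is nonzero; a row in it gives the coefficients of a
   vector [u] whose image is orthogonal to the net. *)
pose A : 'M[R[i]]_(n, N) := \matrix_(i, j) dotp (T (v i)) (enum_fset D)`_j.
have /rowV0Pn[c /sub_kermxP cA c0] : kermx A != 0.
  rewrite -mxrank_eq0 mxrank_ker subn_eq0 -ltnNge.
  exact: leq_ltn_trans (rank_leq_col A) Nn.
pose u := \sum_i c 0 i *: v i.
have u0 : u <> 0.
  move=> /vfree ci0; move/eqP: c0; apply.
  by apply/rowP => i; rewrite ci0 mxE.
have Pu : P u = u.
  by rewrite (linop_sum lP); apply: eq_bigr => i _; rewrite (linopZ lP) vP.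
have Tu (j : 'I_N) : rdot (T u) (enum_fset D)`_j = 0.
  rewrite /rdot (linop_sum lT) dotp_suml.
  have -> : \sum_i dotp (T (c 0 i *: v i)) (enum_fset D)`_j = 0; last by [].
  have /matrixP/(_ 0 j) := cA; rewrite !mxE; apply: etrans.
  by apply: eq_bigr => i _; rewrite (linopZ lT) dotpZl mxE.
have nu : 0 < nrm u by rewrite lt_neqAle nrm_ge0 andbT eq_sym sqrtr_eq0 -ltNge rdot_gt0.
pose w := (nrm u)^-1%:C *: u.
have w1 : rdot w w = 1.
  by rewrite /w !rdotE -sqr_nrm; field; rewrite gt_eqF.
have [|j] := net w; first by rewrite nrm_le// w1 expr1n.
have Pw : P w = w by rewrite /w (linopZ lP) Pu.
have Tw : rdot (T w) (enum_fset D)`_j = 0 by rewrite /w (linopZ lT) rdotZl Tu mulr0.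
have h1 := hT w Pw; rewrite w1 mulr1 in h1.
have h2 : rdot (T w) w <= nrm (T w).
  apply: le_trans (ler_norm _) _; apply: le_trans (rdot_le _ _) _.
  by rewrite [X in _ * X]/nrm w1 sqrtr1 mulr1.
(* By orthogonality a net point is at distance at least [nrm (T w)], hence at least [r], from
   [T w]. *)
apply/negP; rewrite -leNgt; apply: le_trans h1 (le_trans h2 _).
apply: nrm_rdot_le; rewrite !rdotE Tw (rdotC _ (T w)) Tw.
by have := rdot_ge0 ((enum_fset D)`_j); lra.
Qed.

End rank_comparison.

Lemma spectral_projectionP (R : realType) (H : hilbertType R) (S : H -> H) :
  linear S -> rsym S -> (forall x, 0 <= rdot (S x) x) ->
  (forall x, rdot (S x) x <= rdot x x) ->
  is_spectral_measure S (spectral_projection S).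
Proof.
move=> linS symS S_ge0 S_le1; rewrite /spectral_projection.
exact: (xgetPex (fun=> cst 0) (spectral_theorem linS symS S_ge0 S_le1)).
Qed.

(** * Quadratic-form bounds on ranges and kernels of interval projections *)

Section interval_projections.
Context (R : realType) (H : hilbertType R).

(** Same identity as for [rdot_sqr_le], with strictness coming from the term A^2 (c - A). *)
Lemma rdot_sqr_lt (A : H -> H) (c : R) x : linear A -> rsym A -> 0 < c ->
  0 <= rdot (A (c%:C *: x - A x)) (c%:C *: x - A x) ->
  rdot (A (A x)) (A x) < c * rdot (A x) (A x) ->
  rdot (A x) (A x) < c * rdot (A x) x.
Proof.
move=> linA sA c0; rewrite (linopB linA) (linopZ linA) !rdotE (sA (A x) x).
move=> h1 h2; rewrite -(@ltr_pM2l _ c)//; lra.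
Qed.

Section positive_contraction.
Context (S : H -> H) (E : set R -> H -> H).
Hypotheses (linS : linear S) (symS : rsym S) (SE : is_spectral_measure S E).
Implicit Types (x : H) (eps tau : R).

(** With A = S - eps and c = 1 - 2 eps one has S - S^2 - eps (1 - eps) = A (c - A), and both factors
    are positive definite on the range. *)
Lemma defect_gt eps x : eps < 2^-1 ->
  E `]eps, 1 - eps[%classic x = x -> x <> 0 ->
  eps * (1 - eps) * rdot x x < rdot (S x - S (S x)) x.
Proof.
move=> eps2 Px x0; pose c : R := 1 - 2 * eps.
have c0 : 0 < c by rewrite /c; lra.
pose A y := S y - eps%:C *: y.
have linA : linear A.
  by move=> a y z; rewrite /A linS scalerDr scalerBr !scalerA (mulrC a) opprD addrACA.
have symA : rsym A by move=> y z; rewrite /A !rdotE symS.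
have [lP _ _] := spectral_isproj SE (measurable_itv `]eps, 1 - eps[).
have PS y := spectral_commute linS symS SE y (measurable_itv `]eps, 1 - eps[).
have lowS y : E `]eps, 1 - eps[%classic y = y -> y <> 0 -> 0 < rdot (A y) y.
  move=> Py; have [_ h] := spectral_affine SE 1 (- eps) (measurable_itv _) Py.
  have := h _; rewrite /A rdotBl rdotZl mul1r mulNr; apply=> t /=.
  by rewrite in_itv /= => /andP[]; lra.
have upS y : E `]eps, 1 - eps[%classic y = y -> y <> 0 -> rdot (A y) y < c * rdot y y.
  move=> Py y0.
  have [_ h] := spectral_affine SE (-1) (1 - eps) (measurable_itv _) Py.
  have {}h : 0 < -1 * rdot (S y) y + (1 - eps) * rdot y y.
    by apply: h => // t /=; rewrite in_itv /= => /andP[]; lra.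
  by rewrite /A rdotBl rdotZl /c; lra.
have PA y : E `]eps, 1 - eps[%classic y = y -> E `]eps, 1 - eps[%classic (A y) = A y.
  by move=> Py; rewrite (linopB lP) (linopZ lP) PS Py.
have : rdot (A x) (A x) < c * rdot (A x) x.
  (* The strict bound [upS] is applied at [A x], which must be nonzero. *)
  have [Ax0|Ax0] := pselect (A x = 0).
    by have := lowS x Px x0; rewrite Ax0 !rdot0l ltxx.
  apply: rdot_sqr_lt => //; last by apply: upS => //; apply: PA.
  have [->|z0] := pselect (c%:C *: x - A x = 0); first by rewrite rdot0r.
  by apply/ltW/lowS => //; rewrite (linopB lP) (linopZ lP) Px PA.
rewrite /A !rdotE (symS (S x)) (rdotC x (S x)) /c; lra.
Qed.

(** Split [x] along []-oo, eps]] and [[1 - eps, +oo[]. With d = 1 - eps, eps d - (S - S^2) equals (S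
    - eps)^2 + (1 - 2 eps)(eps - S) and also (S - d)^2 + (1 - 2 eps)(S - d); each form is
    nonnegative on its piece. *)
Lemma defect_le eps x : eps < 2^-1 -> E `]eps, 1 - eps[%classic x = 0 ->
  rdot (S x - S (S x)) x <= eps * (1 - eps) * rdot x x.
Proof.
move=> eps2 Px.
have mP := measurable_itv `]eps, 1 - eps[.
have m1 := measurable_itv `]-oo, eps].
have m2 : measurable (~` `]-oo, eps]%classic `&` ~` `]eps, 1 - eps[%classic).
  by apply: measurableI; apply: measurableC.
have [lE sE EE] := spectral_isproj SE m1.
have ES y := spectral_commute linS symS SE y m1.
pose x1 := E `]-oo, eps]%classic x; pose x2 := x - x1.
have E1 : E `]-oo, eps]%classic x1 = x1 by rewrite /x1 EE.
have E2 : E `]-oo, eps]%classic x2 = 0 by rewrite /x2 (linopB lE) EE subrr.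
have E2' : E (~` `]-oo, eps]%classic `&` ~` `]eps, 1 - eps[%classic) x2 = x2.
  have [_ _ idem] := spectral_isproj SE m2.
  have -> : x2 = E (~` `]-oo, eps]%classic `&` ~` `]eps, 1 - eps[%classic) x.
    have mC : measurable (~` `]-oo, eps]%classic) by exact: measurableC.
    have mC' : measurable (~` `]eps, 1 - eps[%classic) by exact: measurableC.
    by rewrite (spectralI SE _ mC mC') !(spectralC SE)// Px subr0.
  exact: idem.
have [h1 _] := spectral_affine SE (-1) eps m1 E1.
have [h2 _] := spectral_affine SE 1 (- (1 - eps)) m2 E2'.
have {}h1 : 0 <= -1 * rdot (S x1) x1 + eps * rdot x1 x1.
  by apply: h1 => t /=; rewrite in_itv /=; lra.
have {}h2 : 0 <= 1 * rdot (S x2) x2 + - (1 - eps) * rdot x2 x2.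
  apply: h2 => t /= [] /negP; rewrite !in_itv /= -ltNge => t1 /negP.
  by rewrite t1 /= -leNgt; lra.
have orth y z : E `]-oo, eps]%classic y = y -> E `]-oo, eps]%classic z = 0 ->
    rdot y z = 0.
  by move=> <- Ez; rewrite sE Ez rdot0r.
have o1 := orth _ _ E1 E2.
have ES1 : E `]-oo, eps]%classic (S x1) = S x1 by rewrite ES E1.
have ES2 : E `]-oo, eps]%classic (S x2) = 0 by rewrite ES E2 (linop0 linS).
have o2 := orth _ _ ES1 E2.
have o3 := orth _ _ ES1 ES2.
have xE : x = x1 + x2 by rewrite /x2 addrC subrK.
clearbody x2; clearbody x1.
have e0 : rdot x x = rdot x1 x1 + rdot x2 x2.
  by rewrite xE !rdotE [rdot x2 x1]rdotC o1; ring.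
have e1 : rdot (S x) x = rdot (S x1) x1 + rdot (S x2) x2.
  by rewrite xE (linopD linS) !rdotE (symS x2 x1) [rdot x2 _]rdotC o2; ring.
have e2 : rdot (S x) (S x) = rdot (S x1) (S x1) + rdot (S x2) (S x2).
  by rewrite xE (linopD linS) !rdotE [rdot (S x2) (S x1)]rdotC o3; ring.
have c0 : 0 <= 1 - 2 * eps by lra.
rewrite rdotBl (symS (S x)) e0 e1 e2.
have := mulr_ge0 c0 h1; have := mulr_ge0 c0 h2.
have := rdot_ge0 (S x1 - eps%:C *: x1); have := rdot_ge0 (S x2 - (1 - eps)%:C *: x2).
rewrite !rdotE (rdotC x1 (S x1)) (rdotC x2 (S x2)); lra.
Qed.

(** Expanding |S x - tau x|^2 >= 0 gives |S x|^2 >= 2 tau <S x, x> - tau^2 |x|^2, and <S x, x> > tau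
    |x|^2. *)
Lemma sqr_gt tau x : 0 < tau -> E `]tau, +oo[%classic x = x -> x <> 0 ->
  tau ^+ 2 * rdot x x < rdot (S x) (S x).
Proof.
move=> tau0 Px x0; have [_ h] := spectral_affine SE 1 (- tau) (measurable_itv _) Px.
have {}h : 0 < 1 * rdot (S x) x + - tau * rdot x x.
  by apply: h => // t /=; rewrite in_itv /= andbT; lra.
have := rdot_ge0 (S x - tau%:C *: x); rewrite !rdotE (rdotC x (S x)); nra.
Qed.

(** On the complementary range 0 <= S <= tau, so S^2 <= tau S <= tau^2. *)
Lemma sqr_le tau x : (forall y, 0 <= rdot (S y) y) -> 0 < tau ->
  E `]tau, +oo[%classic x = 0 -> rdot (S x) (S x) <= tau ^+ 2 * rdot x x.
Proof.
move=> S_ge0 tau0 Px.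
have mP := measurable_itv `]tau, +oo[; have mC := measurableC mP.
have PCx : E (~` `]tau, +oo[%classic) x = x by rewrite (spectralC SE)// Px subr0.
have up y : E (~` `]tau, +oo[%classic) y = y -> rdot (S y) y <= tau * rdot y y.
  move=> Py; have [h _] := spectral_affine SE (-1) tau mC Py.
  have : 0 <= -1 * rdot (S y) y + tau * rdot y y.
    by apply: h => t /= /negP; rewrite in_itv /= andbT -leNgt; lra.
  lra.
have h1 := up _ PCx.
have h2 : rdot (S x) (S x) <= tau * rdot (S x) x.
  apply: rdot_sqr_le => //; apply: up.
  by rewrite (spectral_commute linS symS SE x mC) PCx.
rewrite expr2 -mulrA; apply: le_trans h2 _; rewrite ler_pM2l//.
Qed.

End positive_contraction.
End interval_projections.

(** The choice in [sqrt_op] is genuine once a root exists; [poly_sqrt_op] provides one for X (1 -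
    X), as 1 - X (1 - X) = (1 - X) + X^2. *)
Lemma sqrt_opP (R : realType) (H : hilbertType R) (S : H -> H) :
  linear S -> rsym S -> (forall x, 0 <= rdot (S x) x) ->
  (forall x, rdot (S x) x <= rdot x x) ->
  let D := sqrt_op (S \- (S \o S)) in
  [/\ bounded_operator D, op_le (cst 0) D & D \o D = S \- (S \o S)].
Proof.
move=> linS symS S_ge0 S_le1 /=; rewrite /sqrt_op.
set C := [set B | _].
suff /(xgetPex (cst 0)) : exists B, C B by [].
have p0 : spos S ('X * (1 - 'X)) by apply: sposM; [exact: sposX|exact: spos1X].
have p1 : spos S (1 - 'X * (1 - 'X)).
  have -> : 1 - 'X * (1 - 'X) = (1 - 'X) + 'X ^+ 2 :> {poly R} by ring.
  by apply: sposD; [exact: spos1X|exact: spos_sqr].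
have [B [bB sB B0 BB]] := poly_sqrt_op linS symS S_ge0 S_le1 p0 p1.
exists B; split=> //; first by apply: rdot_op_ge0 => //; case: bB.
apply/funext => x /=; rewrite BB evM// evB// ev1 !evX//.
by rewrite (linopB linS).
Qed.

(** A positive operator is symmetric, and any operator chosen by [adjoint] must agree with it. *)
Lemma abs_op_ge0 (R : realType) (H : hilbertType R) (D : H -> H) :
  bounded_operator D -> op_le (cst 0) D -> abs_op D = sqrt_op (D \o D).
Proof.
move=> bD D0; have linD : linear D by case: bD.
have sD := rsym_dotp linD (ge0_rsym linD D0).
rewrite /abs_op; suff -> : adjoint D = D by [].
rewrite /adjoint; set C := [set B | _].
have [bA hA] : C (xget (cst 0) C) by apply: xgetPex; exists D.
apply/funext => y; apply: rdot_eq => z.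
by rewrite rdotC (rdotC (D y)) /rdot -hA -sD.
Qed.

Theorem theorem2p1 (R : realType) (H : hilbertType R) (S : H -> H)
    (sepH : separable H) (bS : bounded_operator S)
    (S_ge0 : op_le (cst 0) S) (S_le1 : op_le S id) :
  (forall eps : R, 0 < eps < 2^-1 ->
     Lambda eps S =
     ncount (Num.sqrt (eps * (1 - eps))) (sqrt_op (S \- (S \o S)))) /\
  (compact_operator (S \- (S \o S)) ->
     forall eps : R, 0 < eps < 2^-1 -> (Lambda eps S < +oo)%E).
Proof.
have linS : linear S by case: bS.
have symS := ge0_rsym linS S_ge0.
have rS_ge0 x : 0 <= rdot (S x) x by have := op_le_rdot S_ge0 x; rewrite rdot0l.
have rS_le1 := op_le_rdot S_le1.
have SE := spectral_projectionP linS symS rS_ge0 rS_le1.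
split=> [eps /andP[eps0 eps2]|cT eps /andP[eps0 eps2]].
  have [bD D_ge0 DD] := sqrt_opP linS symS rS_ge0 rS_le1.
  (* Rewriting [D \o D] to [S - S^2] turns [sqrt_op (D \o D)] back into [D], so |D| = D. *)
  rewrite /ncount abs_op_ge0// DD.
  set D := sqrt_op _ in bD D_ge0 DD *.
  have linD : linear D by case: bD.
  have symD := ge0_rsym linD D_ge0.
  have rD_ge0 x : 0 <= rdot (D x) x by have := op_le_rdot D_ge0 x; rewrite rdot0l.
  have DxDx x : rdot (D x) (D x) = rdot (S x - S (S x)) x.
    by rewrite -symD -[D (D x)]/((D \o D) x) DD.
  (* [spectral_projectionP] asks for a contraction: |D x|^2 = <(S - S^2) x, x> <= |x|^2. *)
  have rD_le1 x : rdot (D x) x <= rdot x x.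
    apply: le_trans (ler_norm _) _; apply: le_trans (rdot_le _ _) _.
    rewrite -sqr_nrm expr2 ler_wpM2r ?nrm_ge0//; apply: nrm_rdot_le.
    by rewrite DxDx rdotBl (symS (S x)); have := rS_le1 x; have := rdot_ge0 (S x); lra.
  have DF := spectral_projectionP linD symD rD_ge0 rD_le1.
  have tau0 : 0 < eps * (1 - eps) by rewrite mulr_gt0//; lra.
  have tau0' : 0 < Num.sqrt (eps * (1 - eps)) by rewrite sqrtr_gt0.
  have tau2 : Num.sqrt (eps * (1 - eps)) ^+ 2 = eps * (1 - eps).
    by rewrite sqr_sqrtr// ltW.
  have pS := spectral_isproj SE (measurable_itv `]eps, 1 - eps[).
  have pD := spectral_isproj DF (measurable_itv `]Num.sqrt (eps * (1 - eps)), +oo[).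
  apply/eqP; rewrite eq_le; apply/andP; split; apply: le_oprank => // x Px Qx.
    apply: contrapT => x0; have := defect_gt linS symS SE eps2 Px x0.
    by rewrite -DxDx -tau2 ltNge (sqr_le linD symD DF rD_ge0 tau0' Qx).
  apply: contrapT => x0; have := sqr_gt DF tau0' Px x0.
  by rewrite DxDx tau2 ltNge (defect_le linS symS SE eps2 Qx).
apply: (@oprank_lty _ _ _ (S \- (S \o S)) (eps * (1 - eps))) => //.
- exact: (spectral_isproj SE (measurable_itv `]eps, 1 - eps[)).
- move=> a x y /=; rewrite !linS scalerBr opprD addrACA.
  by [].
- by rewrite mulr_gt0//; lra.
- move=> x Px /=; have [->|x0] := pselect (x = 0); first by rewrite !rdot0r mulr0.
  exact/ltW/(defect_gt linS symS SE eps2 Px x0).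
Qed.
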